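(* Let $A \in \mathbb{F}_4[x]$ be a monic polynomial that does not split over $\mathbb{F}_4$, that has at most four distinct monic irreducible factors, and such that the (positive) exponents in its factorization into monic irreducible polynomials are not all odd. Then $A$ is bi-unitary perfect if and only if $A$ can be written as $A = P^aQ^bR^cS^d$ with $P,Q,R,S$ pairwise distinct monic irreducible polynomials in $\mathbb{F}_4[x]$ and $a,b,c,d \in \mathbb{N}$ such that one of the following conditions holds: i) $a=b=c=d=2$, $P,R \in \Omega_1$, $Q=P+1$ and $S=R+1$; ii) $a=b=2$, $c=d=2^n-1$ for some $n \in \mathbb{N}$, $P,R \in \Omega_1$, $Q=P+1$ and $S=R+1$; iii) $a=b=2^n-1$ for some $n \in \mathbb{N}$, $c=d=2$, $P,R \in \Omega_1$, $Q=P+1$ and $S=R+1$; iv) $P \in \Omega_2$, $Q=P+1$, $R,S \in \{P^3+P+1,\ P^3+P^2+1\}$ and $(a,b,c,d) \in \{(7,13,2,2),(13,7,2,2),(14,14,2,2)\}$.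
   Context: $\mathbb{F}_4=\{0,1,\alpha,\alpha+1\}$ with $\alpha^2+\alpha+1=0$ is the field with four elements; $\mathbb{N}$ is the set of nonnegative integers. All polynomials (including all divisors) are monic. A polynomial splits over $\mathbb{F}_4$ if it is a product of polynomials of degree $1$ over $\mathbb{F}_4$ (the constant $1$ splits). For a nonzero polynomial $S\in\mathbb{F}_4[x]$, a divisor $D$ of $S$ is unitary if $\gcd(D,S/D)=1$. For nonzero polynomials $S,T$, $\gcd_u(S,T)$ denotes the greatest common unitary divisor of $S$ and $T$, i.e. the monic polynomial of largest degree that is a unitary divisor of both $S$ and $T$. A divisor $D$ of $S$ is bi-unitary if $\gcd_u(D,S/D)=1$. $\sigma^{**}(S)$ denotes the sum of all monic bi-unitary divisors of $S$, and $S$ is bi-unitary perfect (b.u.p.) if $\sigma^{**}(S)=S$. $\Omega_1$ is the set of monic $P\in\mathbb{F}_4[x]$ such that $P$ and $P+1$ are both irreducible. $\Omega_2$ is the set of monic $P\in\mathbb{F}_4[x]$ such that $P$, $P+1$, $P^3+P+1$ and $P^3+P^2+1$ are all irreducible. *)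

(* Defs.v *)
From HB Require Import structures.
From mathcomp Require Import all_boot all_order all_algebra all_field.

Set Implicit Arguments.
Unset Strict Implicit.
Unset Printing Implicit Defensive.

Import GRing.Theory.
Local Open Scope ring_scope.

Section BiUnitary.

Variable F : finFieldType.
Implicit Types D P S T A : {poly F}.

Definition monic_divisors S : seq {poly F} :=
  [seq D <- [seq polyn p | p : {poly_(size S) F}] | (D \is monic) && (D %| S)].

Definition unitary_divisor D S : bool :=
  [&& D \is monic, D %| S & coprimep D (S %/ D)].

(* For S != 0, npolyp (size S) 1 is the polynomial 1, a common unitary divisor
   of S and T; see gcduP. *)
Definition gcdu S T : {poly F} :=
  polyn [arg max_(D > npolyp (size S) 1
                  | unitary_divisor (polyn D) S && unitary_divisor (polyn D) T)
          size (polyn D)]%N.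

Definition biunitary_divisor D S : bool :=
  [&& D \is monic, D %| S & gcdu D (S %/ D) == 1].

Definition sigma_bu S : {poly F} :=
  \sum_(D <- monic_divisors S | biunitary_divisor D S) D.

Definition biunitary_perfect S : Prop := sigma_bu S = S.

Definition splits S : Prop :=
  exists2 s : seq {poly F},
    all (fun L => (L \is monic) && (size L == 2%N)) s & S = \prod_(L <- s) L.

Definition irr_factors A : seq {poly F} :=
  [seq P <- monic_divisors A | irreducibleb P].

(* The bound k < size A is no restriction when size P > 1 and A != 0. *)
Definition multiplicity P A : nat := \max_(k < size A | P ^+ k %| A) k.

Definition Omega1 P : Prop :=
  [/\ P \is monic, irreducible_poly P & irreducible_poly (P + 1)].

Definition Omega2 P : Prop :=
  [/\ P \is monic, irreducible_poly P, irreducible_poly (P + 1),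
      irreducible_poly (P ^+ 3 + P + 1) & irreducible_poly (P ^+ 3 + P ^+ 2 + 1)].

Lemma mem_monic_divisors S D : S != 0 ->
  (D \in monic_divisors S) = (D \is monic) && (D %| S).
Proof.
move=> S0; rewrite mem_filter; apply: andb_idr => /andP[_ dvDS].
have sD : (size D <= size S)%N by rewrite dvdp_leq.
by apply/mapP; exists (npolyp (size S) D); rewrite ?mem_enum ?npolypK.
Qed.

Lemma monic_divisors_uniq S : uniq (monic_divisors S).
Proof. by rewrite filter_uniq // map_inj_uniq ?enum_uniq //; apply: val_inj. Qed.

Lemma gcduP S T : S != 0 ->
  [/\ unitary_divisor (gcdu S T) S, unitary_divisor (gcdu S T) T
    & forall D, unitary_divisor D S -> unitary_divisor D T ->
        (size D <= size (gcdu S T))%N].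
Proof.
move=> S0; have E1 : polyn (npolyp (size S) (1 : {poly F})) = 1.
  by apply: npolypK; rewrite size_poly1 size_poly_gt0.
have u1 U : unitary_divisor 1 U.
  by rewrite /unitary_divisor monic1 dvd1p coprime1p.
rewrite /gcdu; case: arg_maxnP => [|D /andP[uS uT] Dmax]; first by rewrite E1 !u1.
split=> // D' uS' uT'.
have sD' : (size D' <= size S)%N by case/and3P: uS' => _ /dvdp_leq ->.
by have := Dmax (npolyp (size S) D'); rewrite /= npolypK // uS' uT'; apply.
Qed.

Lemma mem_irr_factors A P : A != 0 ->
  reflect [/\ P \is monic, irreducible_poly P & P %| A] (P \in irr_factors A).
Proof.
move=> A0; rewrite mem_filter mem_monic_divisors //.
by apply: (iffP and3P) => [[/irreducibleP]|[? /irreducibleP]].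
Qed.

End BiUnitary.

(* Main.v *)
(* For odd a, sigma_bu (P^a) = 1 + P + .. + P^a; for a = 2m > 0 the term P^m
   drops out, and in characteristic 2
     sigma_bu (P^a) = (P + 1) (1 + .. + P^m) (1 + .. + P^(m-1)).
   With geom P n := 1 + .. + P^(n-1) one has
     geom P (2^r u) = (P + 1)^(2^r - 1) (geom P u)^(2^r),
   so everything is governed by the factors geom P u with u odd. If P has
   minimal degree among the prime factors of A, then P + 1 is a prime factor
   too, and geom P u is coprime to P and P + 1. Differentiating
   (P + 1) geom P u = P^u + 1 shows that a prime factor of A of degree at least
   deg P divides geom P u at most once, and geom P u is not irreducible since
   it comes from a polynomial of even degree over F_2. So geom P u = R S with R
   and S the two other prime factors, both R + 1 and S + 1 are products of
   prime factors of A, and differentiating once more leaves only u = 7 and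
   {R, S} = {P^3 + P + 1, P^3 + P^2 + 1}. If no such u occurs for P and P + 1,
   degrees force sigma_bu (R^c) = S^d and sigma_bu (S^d) = R^c, hence
   S = R + 1. *)

Require Import Defs.
From HB Require Import structures.
From mathcomp Require Import all_boot all_order all_fingroup all_algebra.
From mathcomp Require Import all_solvable all_field.
From mathcomp Require Import ring zify.

Set Implicit Arguments.
Unset Strict Implicit.
Unset Printing Implicit Defensive.

Import GRing.Theory.
Local Open Scope ring_scope.

(** * Divisors of products of powers of monic irreducible polynomials *)

Section MonicDivisors.

Variable F : fieldType.
Implicit Types P Q R S T U V D E A B : {poly F}.

(** The substitution X -> X + 1 exchanges the two cubic factors of X^6 + .. + X + 1 over F_2, so P
    and P + 1 produce the same R and S, while R + 1 and S + 1 are P (P + 1)^2 and P^2 (P + 1). This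
    closed system of four primes is the source of the exponents 7, 13 and 14. The competing case is
    u = 3. Over F_4, 1 + P + P^2 = (P + w) (P + w + 1) with w a primitive cube root of unity, and P,
    P + 1, P + w, P + w + 1 are all irreducible only when they are linear; there the assumption that
    A does not split is used. The assumption on the exponents excludes that both pairs P, P + 1 and
    R, R + 1 carry exponents 2^n - 1. To treat two, three and four prime factors at once, A is
    always written with four distinct primes, the missing ones being linear polynomials with
    exponent 0. Degree hypotheses on R and S are therefore conditional on a positive exponent. *)

Lemma monic_dvdp_anti P Q :
  P \is monic -> Q \is monic -> P %| Q -> Q %| P -> P = Q.
Proof.
by move=> mP mQ PQ QP; apply/eqP; rewrite -eqp_monic // /eqp PQ QP.
Qed.

Lemma monic_dvdpP D S : S \is monic -> D \is monic -> D %| S ->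
  exists2 E, E \is monic & S = D * E.
Proof.
move=> mS mD /dvdpP[E SE]; exists E; last by rewrite mulrC.
by move: mS; rewrite SE monicMr.
Qed.

Lemma monic_size1 P : P \is monic -> size P = 1%N -> P = 1.
Proof.
move=> mP /eqP/size_poly1P[c c0 Pc].
by move: mP; rewrite Pc monicE lead_coefC => /eqP ->.
Qed.

Lemma monic_dvdp_eq P Q : P \is monic -> Q \is monic -> P %| Q ->
  (size Q <= size P)%N -> P = Q.
Proof.
move=> mP mQ PQ sQP; apply/eqP; rewrite -eqp_monic // -dvdp_size_eqp //.
by rewrite eqn_leq sQP dvdp_leq ?monic_neq0.
Qed.

Lemma irredp_coprime P Q : P \is monic -> Q \is monic ->
  irreducible_poly P -> irreducible_poly Q -> P != Q -> coprimep P Q.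
Proof.
move=> mP mQ iP iQ PQ; rewrite irreducible_poly_coprime //.
apply: contra PQ => dPQ; rewrite -eqp_monic //; apply: iQ dPQ.
by case: (iP) => + _; case: (size P) => [|[]].
Qed.

Lemma irredp_dvdpM P Q R : irreducible_poly P ->
  (P %| Q * R) = (P %| Q) || (P %| R).
Proof.
move=> iP; apply/idP/orP => [PQR|[]]; last 2 first.
- exact: dvdp_mulr.
- exact: dvdp_mull.
have [|cPQ] := boolP (P %| Q); first by left.
by right; rewrite -(Gauss_dvdpr _ (_ : coprimep P Q)) // irreducible_poly_coprime.
Qed.

Lemma irredp_dvdpX P Q n : irreducible_poly P -> P %| Q ^+ n -> P %| Q.
Proof.
move=> iP; elim: n => [|n IHn].
  rewrite expr0 dvdp1; case: (iP) => + _ /eqP sP.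
  by rewrite sP.
by rewrite exprS irredp_dvdpM // => /orP[].
Qed.

Lemma dvdp_irredXM P D B a : P \is monic -> irreducible_poly P ->
    D \is monic -> D %| P ^+ a * B ->
  exists i E, [/\ (i <= a)%N, E \is monic, D = P ^+ i * E & E %| B].
Proof.
move=> mP iP; elim: a => [|a IHa] in D *.
  by rewrite mul1r => mD DB; exists 0%N, D; rewrite mul1r.
move=> mD; have [PD|nPD] := boolP (P %| D).
  have [D' mD' ->] := monic_dvdpP mD mP PD.
  rewrite exprS -mulrA dvdp_mul2l ?monic_neq0 // => /IHa[//|i [E [ia mE -> EB]]].
  by exists i.+1, E; rewrite exprS mulrA.
rewrite Gauss_dvdpr => [DB|]; first by exists 0%N, D; rewrite mul1r.
by rewrite coprimep_sym coprimep_expl // irreducible_poly_coprime.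
Qed.

(** D1 is the monic gcd of D and S. The rest of D is coprime to S / D1, hence divides T. *)
Lemma coprime_dvdpM D S T : coprimep S T -> S \is monic -> T \is monic ->
    D \is monic -> D %| S * T ->
  exists D1 D2, [/\ D1 \is monic, D2 \is monic, D1 %| S, D2 %| T & D = D1 * D2].
Proof.
move=> cST mS mT mD DST.
pose g := gcdp D S; have g0 : g != 0 by rewrite gcdp_eq0 negb_and !monic_neq0.
(* [gcdp] is determined only up to a unit; D1 is its monic multiple. *)
pose D1 := (lead_coef g)^-1 *: g.
have lg : (lead_coef g)^-1 != 0 by rewrite invr_eq0 lead_coef_eq0.
have mD1 : D1 \is monic by rewrite monicE lead_coefZ mulVf ?lead_coef_eq0.
have gD1 : D1 %= g by apply: eqp_scale.
have D1D : D1 %| D by rewrite (eqp_dvdl _ gD1) dvdp_gcdl.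
have D1S : D1 %| S by rewrite (eqp_dvdl _ gD1) dvdp_gcdr.
have [D2 mD2 DE] := monic_dvdpP mD mD1 D1D.
have [S2 mS2 SE] := monic_dvdpP mS mD1 D1S.
exists D1, D2; split=> //.
have cDS : coprimep D2 S2.
  have := @coprimep_div_gcd _ D S; rewrite -/g (monic_neq0 mD) => /(_ isT).
  rewrite -(eqp_coprimepl _ (eqp_divr D gD1)) -(eqp_coprimepr _ (eqp_divr S gD1)).
  by rewrite {1}DE {1}SE !mulKp ?monic_neq0.
move: DST; rewrite DE {1}SE -mulrA dvdp_mul2l ?monic_neq0 //.
by rewrite Gauss_dvdpr.
Qed.

Lemma dvdp_irred4 P Q R S D a b c d :
    [/\ P \is monic, Q \is monic, R \is monic & S \is monic] ->
    [/\ irreducible_poly P, irreducible_poly Q, irreducible_poly R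
      & irreducible_poly S] ->
    D \is monic -> D %| P ^+ a * Q ^+ b * R ^+ c * S ^+ d ->
  exists i j k l, [/\ (i <= a)%N, (j <= b)%N, (k <= c)%N, (l <= d)%N
                    & D = P ^+ i * Q ^+ j * R ^+ k * S ^+ l].
Proof.
move=> [mP mQ mR mS] [iP iQ iR iS] mD; rewrite -!mulrA.
case/(dvdp_irredXM mP iP mD) => i [D1 [ia mD1 ->]].
case/(dvdp_irredXM mQ iQ mD1) => j [D2 [jb mD2 ->]].
case/(dvdp_irredXM mR iR mD2) => k [D3 [kc mD3 ->]].
rewrite -[S ^+ d]mulr1; case/(dvdp_irredXM mS iS mD3) => l [D4 [ld mD4 ->]].
rewrite dvdp1 => /eqP/(monic_size1 mD4) ->.
by exists i, j, k, l; rewrite mulr1 !mulrA.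
Qed.

Lemma exp_irred_inj P A B i j : irreducible_poly P ->
  ~~ (P %| A) -> ~~ (P %| B) -> P ^+ i * A = P ^+ j * B -> i = j.
Proof.
move=> iP; have [sP _] := iP; have P0 : P != 0 by rewrite -size_poly_gt0 ltnW.
wlog ij : A B i j / (i <= j)%N.
  move=> W nA nB E; case/orP: (leq_total i j) => ij; first exact: W ij nA nB E.
  by rewrite (W B A j i ij nB nA (esym E)).
move=> nA _; rewrite -(subnKC ij) exprD -mulrA => /(mulfI (expf_neq0 _ P0)) AE.
have [|ji] := posnP (j - i); first by lia.
by case/negP: nA; rewrite AE dvdp_mulr // dvdp_exp.
Qed.

Lemma irred4_inj P Q R S a b c d a' b' c' d' :
    [/\ P \is monic, Q \is monic, R \is monic & S \is monic] ->
    [/\ irreducible_poly P, irreducible_poly Q, irreducible_poly R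
      & irreducible_poly S] ->
    uniq [:: P; Q; R; S] ->
    P ^+ a * Q ^+ b * R ^+ c * S ^+ d = P ^+ a' * Q ^+ b' * R ^+ c' * S ^+ d' ->
  [/\ a = a', b = b', c = c' & d = d'].
Proof.
move=> [mP mQ mR mS] [iP iQ iR iS].
rewrite /= !inE !negb_or => /and4P[/and3P[PQ PR PS] /andP[QR QS] RS _].
have ndvdX T U n : T \is monic -> U \is monic -> irreducible_poly T ->
    irreducible_poly U -> T != U -> ~~ (T %| U ^+ n).
  move=> mT mU iT iU TU; apply/negP => /(irredp_dvdpX iT).
  by have := irredp_coprime mT mU iT iU TU; rewrite irreducible_poly_coprime // => /negP.
rewrite -!mulrA => E.
have aa' : a = a' by apply: exp_irred_inj E => //; rewrite !irredp_dvdpM // !negb_or !ndvdX.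
move: E; rewrite aa' => /(mulfI (expf_neq0 _ (monic_neq0 mP))) E.
have bb' : b = b' by apply: exp_irred_inj E => //; rewrite !irredp_dvdpM // !negb_or !ndvdX.
move: E; rewrite bb' => /(mulfI (expf_neq0 _ (monic_neq0 mQ))) E.
have cc' : c = c' by apply: exp_irred_inj E => //; rewrite ?ndvdX.
move: E; rewrite cc' => /(mulfI (expf_neq0 _ (monic_neq0 mR))) E.
split=> //; apply: (@exp_irred_inj S 1 1) => //; rewrite ?mulr1 // dvdp1.
- by case: (iS) => + _; case: (size S) => [|[]].
- by case: (iS) => + _; case: (size S) => [|[]].
Qed.

End MonicDivisors.

(** * Bi-unitary divisors and multiplicativity of their sum *)

Section Sigma.

Variable F : finFieldType.
Implicit Types P Q R S T U V D E A B : {poly F}.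

Lemma unitary_divisorM U V : U \is monic ->
  unitary_divisor U (U * V) = coprimep U V.
Proof. by move=> mU; rewrite /unitary_divisor mU dvdp_mulr ?mulKp ?monic_neq0. Qed.

Lemma unitary_divisorP U D : D \is monic ->
  reflect (exists V, [/\ U \is monic, V \is monic, D = U * V & coprimep U V])
          (unitary_divisor U D).
Proof.
move=> mD; apply: (iffP idP) => [uU|[V [mU _ -> cUV]]]; last by rewrite unitary_divisorM.
have /and3P[mU UD _] := uU; have [V mV DE] := monic_dvdpP mD mU UD.
by exists V; split=> //; rewrite -(unitary_divisorM V mU) -DE.
Qed.

(** The polynomial 1 is the only monic one of size 1, so maximality of [gcdu] turns into the absence
    of other common unitary divisors. From here on [gcdu] itself is no longer needed. *)
Lemma biunitary_divisorM D E : D \is monic -> E \is monic ->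
  reflect (forall U, unitary_divisor U D -> unitary_divisor U E -> U = 1)
          (biunitary_divisor D (D * E)).
Proof.
move=> mD mE; have D0 := monic_neq0 mD.
rewrite /biunitary_divisor mD dvdp_mulr ?mulKp //=.
have [uD uE max_gcdu] := gcduP E D0.
apply: (iffP eqP) => [g1 U UD UE|]; last exact.
have /and3P[mU _ _] := UD; apply: monic_size1 => //.
apply/eqP; rewrite eqn_leq size_poly_gt0 monic_neq0 // andbT.
by have := max_gcdu U UD UE; rewrite g1 size_poly1.
Qed.

(** A common unitary divisor of D1 * D2 and E1 * E2 splits into U1 * U2 along D1, D2; U1 is coprime
    to E2, so it divides E1, and unitarity is inherited by each part. Conversely, a common unitary
    divisor on one side stays unitary after multiplication by the coprime other side. *)
Lemma biunitary_divisorMM D1 E1 D2 E2 :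
    D1 \is monic -> E1 \is monic -> D2 \is monic -> E2 \is monic ->
    coprimep (D1 * E1) (D2 * E2) ->
  biunitary_divisor (D1 * D2) (D1 * E1 * (D2 * E2)) =
  biunitary_divisor D1 (D1 * E1) && biunitary_divisor D2 (D2 * E2).
Proof.
move=> mD1 mE1 mD2 mE2 cop.
move: (cop); rewrite !coprimepMl !coprimepMr.
case/andP=> /andP[cDD cDE] /andP[cED cEE].
rewrite mulrACA; apply/biunitary_divisorM/andP; rewrite ?monicMr //.
  move=> uDE; split; apply/biunitary_divisorM => // U.
    case/unitary_divisorP=> // V [mU mV DE cUV].
    case/unitary_divisorP=> // W [_ mW EE cUW].
    apply: uDE; rewrite ?DE ?EE -mulrA unitary_divisorM // coprimepMr ?cUV ?cUW /=.
      by apply: coprimep_dvdr cDD; rewrite DE dvdp_mulr.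
    by apply: coprimep_dvdr cDE; rewrite DE dvdp_mulr.
  case/unitary_divisorP=> // V [mU mV DE cUV].
  case/unitary_divisorP=> // W [_ mW EE cUW].
  apply: uDE; rewrite ?DE ?EE mulrCA unitary_divisorM // coprimepMr ?cUV ?cUW ?andbT.
    by rewrite coprimep_sym; apply: coprimep_dvdl cDD; rewrite DE dvdp_mulr.
  by rewrite coprimep_sym; apply: coprimep_dvdl cED; rewrite DE dvdp_mulr.
case=> /biunitary_divisorM u1 /biunitary_divisorM u2 U.
case/unitary_divisorP=> [|V [mU mV DE cUV]]; first by rewrite monicMr.
case/unitary_divisorP=> [|W [_ mW EE cUW]]; first by rewrite monicMr.
have [|U1 [U2 [mU1 mU2 U1D U2D UE]]] := @coprime_dvdpM _ U D1 D2 cDD mD1 mD2 mU.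
  by rewrite DE dvdp_mulr.
have [V1 mV1 D1E] := monic_dvdpP mD1 mU1 U1D.
have [V2 mV2 D2E] := monic_dvdpP mD2 mU2 U2D.
have VE : V = V1 * V2.
  apply: (mulfI (monic_neq0 mU)); rewrite -DE D1E D2E UE; ring.
have U1E : U1 %| E1.
  rewrite -(Gauss_dvdpl E1 (_ : coprimep U1 E2)).
    by rewrite EE UE -mulrA dvdp_mulr.
  by apply: coprimep_dvdr U1D cDE.
have U2E : U2 %| E2.
  rewrite -(Gauss_dvdpr E2 (_ : coprimep U2 E1)).
    by rewrite EE UE -mulrA dvdp_mull // dvdp_mulr.
  by rewrite coprimep_sym; apply: coprimep_dvdl U2D cED.
have [W1 mW1 E1E] := monic_dvdpP mE1 mU1 U1E.
have [W2 mW2 E2E] := monic_dvdpP mE2 mU2 U2E.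
have WE : W = W1 * W2.
  apply: (mulfI (monic_neq0 mU)); rewrite -EE E1E E2E UE; ring.
move: cUV cUW; rewrite VE WE UE !coprimepMl !coprimepMr.
case/andP=> /andP[c11 _] /andP[_ c22] /andP[/andP[d11 _] /andP[_ d22]].
have -> : U1 = 1.
  by apply: (u1 mD1 mE1); [rewrite D1E | rewrite E1E]; rewrite unitary_divisorM.
have -> : U2 = 1.
  by apply: (u2 mD2 mE2); [rewrite D2E | rewrite E2E]; rewrite unitary_divisorM.
exact: mulr1.
Qed.

(** Multiplication is a bijection from pairs of bi-unitary divisors of S and of T onto those of S *
    T; it is injective because the two sides are coprime and all divisors are monic. *)
Lemma sigma_buM S T : S \is monic -> T \is monic -> coprimep S T ->
  sigma_bu (S * T) = sigma_bu S * sigma_bu T.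
Proof.
move=> mS mT cST; have [S0 T0] := (monic_neq0 mS, monic_neq0 mT).
have ST0 : S * T != 0 by rewrite mulf_neq0.
pose bd A := [seq D <- monic_divisors A | biunitary_divisor D A].
have bdE A : sigma_bu A = \sum_(D <- bd A) D by rewrite big_filter.
have mem_bd A D : A != 0 -> (D \in bd A) = biunitary_divisor D A.
  move=> A0; rewrite mem_filter mem_monic_divisors //.
  by apply: andb_idr => /and3P[-> -> _].
rewrite !bdE big_distrlr /= -(big_allpairs_dep (h := fun D1 D2 => D1 * D2) (F := id)).
apply: perm_big; apply: uniq_perm; first by rewrite filter_uniq ?monic_divisors_uniq.
  apply: allpairs_uniq; try exact: filter_uniq (monic_divisors_uniq _).
  have dvd_fst D1 D2 D1' D2' : D1 %| S -> D2' %| T -> D1 * D2 = D1' * D2' -> D1 %| D1'.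
    move=> D1S D2T E; rewrite -(Gauss_dvdpl _ (_ : coprimep D1 D2')).
      by rewrite -E dvdp_mulr.
    exact: coprimep_dvdr D1S (coprimep_dvdl D2T cST).
  move=> _ _ /allpairsP[[D1 D2] /= [D1S D2T ->]] /allpairsP[[D1' D2'] /= [D1S' D2T' ->]] /= E.
  move: D1S D2T D1S' D2T'; rewrite !mem_bd //.
  move=> /and3P[mD1 D1S _] /and3P[mD2 D2T _] /and3P[mD1' D1S' _] /and3P[mD2' D2T' _].
  have E1 : D1 = D1'.
    by apply: monic_dvdp_anti => //; [apply: dvd_fst E | apply: dvd_fst (esym E)].
  by move: E; rewrite E1 => /(mulfI (monic_neq0 mD1'))->.
move=> D; rewrite mem_bd //; apply/idP/allpairsP => [bD|[[D1 D2] /= []]].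
  have /and3P[mD DST _] := bD.
  have [D1 [D2 [mD1 mD2 D1S D2T DE]]] := coprime_dvdpM cST mS mT mD DST.
  have [E1 mE1 SE] := monic_dvdpP mS mD1 D1S.
  have [E2 mE2 TE] := monic_dvdpP mT mD2 D2T.
  exists (D1, D2); rewrite !mem_bd //=; move: bD.
  rewrite DE SE TE biunitary_divisorMM // -?SE -?TE // => /andP[-> ->].
  by split.
rewrite !mem_bd // => b1 b2 ->.
have /and3P[mD1 D1S _] := b1; have /and3P[mD2 D2T _] := b2.
have [E1 mE1 SE] := monic_dvdpP mS mD1 D1S.
have [E2 mE2 TE] := monic_dvdpP mT mD2 D2T.
by rewrite SE TE biunitary_divisorMM // -?SE -?TE // b1 b2.
Qed.

(** The clause [k == 0] keeps the term 1 for a = 0, where the middle exponent is 0 itself. *)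
Definition bu_sum P a := \sum_(k < a.+1 | (k == 0%N :> nat) || (k.*2 != a)) P ^+ k.

(** The only unitary divisors of P^i are 1 and P^i. Hence P^i and P^(a - i) have a common one
    besides 1 exactly when i = a - i > 0. *)
Lemma sigma_buX P a : P \is monic -> irreducible_poly P ->
  sigma_bu (P ^+ a) = bu_sum P a.
Proof.
move=> mP iP; have P0 := monic_neq0 mP; have sP : (1 < size P)%N by case: iP.
have Pa0 : P ^+ a != 0 by rewrite expf_neq0.
have injP : injective (fun k => P ^+ k).
  move=> i j /= E; apply/eqP; rewrite eqn_leq -!(dvdp_Pexp2l _ _ sP) E.
  by rewrite dvdpp.
have divP n D : D \is monic -> D %| P ^+ n -> exists2 i, (i <= n)%N & D = P ^+ i.
  move=> mD; rewrite -[P ^+ n]mulr1 => /(dvdp_irredXM mP iP mD)[i [E [ia mE ->]]].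
  rewrite dvdp1 => /eqP/(monic_size1 mE)->; exists i; rewrite ?mulr1 //.
have uniX i U : unitary_divisor U (P ^+ i) -> U = 1 \/ U = P ^+ i.
  case/unitary_divisorP=> [|V [mU mV E cUV]]; first exact: monic_exp.
  have [//||j ji UE] := divP i U; first by rewrite E dvdp_mulr.
  have [//||k ki VE] := divP i V; first by rewrite E dvdp_mull.
  have [j0|j0] := posnP j; first by left; rewrite UE j0.
  have [k0|k0] := posnP k; first by right; rewrite E VE k0 expr0 mulr1.
  move: cUV; rewrite UE VE coprimep_pexpl ?coprimep_pexpr // coprimepp.
  by rewrite gtn_eqF.
have biuX i : (i <= a)%N ->
    biunitary_divisor (P ^+ i) (P ^+ a) = (i == 0%N) || (i.*2 != a).
  move=> ia; rewrite -{1}(subnKC ia) exprD; apply/biunitary_divisorM/idP; rewrite ?monic_exp //.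
    move=> uPi; apply/norP => -[i0 /negPn/eqP aE].
    have ii : (a - i)%N = i by rewrite -aE -addnn addnK.
    have uii : unitary_divisor (P ^+ i) (P ^+ i).
      by rewrite -[X in unitary_divisor _ X]mulr1 unitary_divisorM ?monic_exp ?coprimep1.
    have := uPi _ uii; rewrite ii => /(_ uii); rewrite -[1](expr0 P) => /injP i00.
    by rewrite i00 in i0.
  move=> ii U /uniX[//|->] /uniX[//|/injP E].
  case/orP: ii => [/eqP->//|/negP[]]; apply/eqP; lia.
pose ks := [seq k <- index_iota 0 a.+1 | (k == 0%N) || (k.*2 != a)].
rewrite /sigma_bu -big_filter.
transitivity (\sum_(D <- [seq P ^+ k | k <- ks]) D); last first.
  by rewrite big_map big_filter big_mkord.
apply: perm_big; apply: uniq_perm; first by rewrite filter_uniq ?monic_divisors_uniq.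
  by rewrite map_inj_uniq // filter_uniq // iota_uniq.
move=> D; rewrite mem_filter mem_monic_divisors //; apply/and3P/mapP.
  case=> bD mD DP; have [i ia DE] := divP a D mD DP.
  by exists i => //; rewrite mem_filter -biuX // -DE bD mem_index_iota.
case=> i; rewrite mem_filter mem_index_iota ltnS => /and3P[ii _ ia ->].
by rewrite biuX // ii monic_exp // dvdp_exp2l.
Qed.

End Sigma.

(** * Geometric sums in characteristic 2 *)

Section Char2.

Variable F : finFieldType.
Hypothesis char2 : 2%N \in [pchar F].
Implicit Types P Q R S T U V D E A B : {poly F}.

Let char2p : 2%N \in [pchar {poly F}].
Proof. by rewrite pchar_poly. Qed.

Lemma addr_eq0_pchar2 P Q : P + Q = 0 -> P = Q.
Proof. by move/eqP; rewrite addr_eq0 oppr_pchar2 // => /eqP. Qed.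

Lemma size_addp1 P : (1 < size P)%N -> size (P + 1) = size P.
Proof. by move=> sP; rewrite size_polyDl // size_poly1. Qed.

Lemma mulrn_pchar2 P n : P *+ n = P *+ odd n.
Proof.
by rewrite -{1}(odd_double_half n) mulrnDr -mul2n mulrnA mulr2n addrr_pchar2 // mul0rn addr0.
Qed.

(** Throughout, [(size P).-1] stands for the degree of P. *)
Lemma deg_mul P Q : P != 0 -> Q != 0 ->
  (size (P * Q)).-1 = ((size P).-1 + (size Q).-1)%N.
Proof.
move=> P0 Q0; rewrite size_mul //; move: P0 Q0; rewrite -!size_poly_gt0.
by move: (size P) (size Q) => p q; lia.
Qed.

Lemma monic_addp1 P : (1 < size P)%N -> (P + 1 \is monic) = (P \is monic).
Proof. by move=> sP; rewrite !monicE lead_coefDl // size_poly1. Qed.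

Lemma exprD_pow2 P Q r : (P + Q) ^+ (2 ^ r) = P ^+ (2 ^ r) + Q ^+ (2 ^ r).
Proof. by rewrite exprDn_pchar // (eq_pnat _ (pcharf_eq char2p)) pnatX pnat_id. Qed.

Definition geom P n := \sum_(k < n) P ^+ k.

Lemma geomM P n : (P + 1) * geom P n = P ^+ n + 1.
Proof. by have := subrX1 P n; rewrite !GRing.subr_pchar2 // => ->. Qed.

Lemma geom0 P : geom P 0 = 0. Proof. exact: big_ord0. Qed.

Lemma geomS P n : geom P n.+1 = 1 + P * geom P n.
Proof.
rewrite /geom big_ord_recl expr0 big_distrr; congr (_ + _).
by apply: eq_bigr => i _; rewrite lift0 exprS.
Qed.

Lemma geomSr P n : geom P n.+1 = geom P n + P ^+ n.
Proof. exact: big_ord_recr. Qed.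

Lemma geom1 P : geom P 1 = 1. Proof. by rewrite geomS geom0 mulr0 addr0. Qed.

Lemma coprimep_1addM P Q : coprimep P (1 + P * Q).
Proof. by rewrite addrC mulrC coprimep_addl_mul coprimep1. Qed.

Lemma coprime_geom P n : coprimep P (geom P n.+1).
Proof. by rewrite geomS coprimep_1addM. Qed.

(** Modulo P + 1 every power of P is 1, so [geom P u] reduces to u, that is, to 1. *)
Lemma coprime_addp1_geom P u : odd u -> coprimep (P + 1) (geom P u).
Proof.
move=> ou; suff [t ->] : exists t, geom P u = 1 + (P + 1) * t.
  exact: coprimep_1addM.
rewrite -(odd_double_half u) ou add1n; elim: (u./2) => [|w [t IHw]].
  by exists 0; rewrite geom1 mulr0 addr0.
rewrite doubleS 2!geomSr IHw [P ^+ _.+2]exprS; exists (t + P ^+ (w.*2).+1).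
by move: (P ^+ _.+1) => X; ring.
Qed.

Section Geom.

Variables (P : {poly F}) (sP : (1 < size P)%N).

Let Q0 : P + 1 != 0.
Proof. by rewrite -size_poly_eq0 size_addp1 //; case: size sP. Qed.

(** After multiplication by P + 1 both sides are P^(2^r u) + 1, the 2^r-th power of P^u + 1. *)
Lemma geom_pow2 r u :
  geom P (2 ^ r * u) = (P + 1) ^+ (2 ^ r - 1) * geom P u ^+ (2 ^ r).
Proof.
apply: (mulfI Q0); rewrite mulrA -exprS -subSn ?expn_gt0 // subn1 /= -exprMn !geomM.
by rewrite exprD_pow2 expr1n -exprM mulnC.
Qed.

Lemma size_geom n : (size (geom P n.+1)).-1 = ((size P).-1 * n)%N.
Proof.
have g0 : geom P n.+1 != 0.
  apply/eqP => g0; have := coprime_geom P n; rewrite g0 coprimep0 -size_poly_eq1.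
  by case: size sP => [|[]].
have := congr1 (fun A : {poly F} => (size A).-1) (geomM P n.+1).
have sX : (1 < size (P ^+ n.+1))%N.
  by have := size_exp P n.+1; case: size sP => [|[|p]] //=; case: size => [|[]].
by rewrite deg_mul // !size_addp1 // size_exp mulnS => /addnI.
Qed.

Lemma monic_geom n : P \is monic -> geom P n.+1 \is monic.
Proof.
move=> mP; rewrite -(monicMl _ (_ : P + 1 \is monic)) ?monic_addp1 // geomM.
rewrite monic_addp1 ?monic_exp //.
by have := size_exp P n.+1; case: size sP => [|[|p]] //=; case: size => [|[]].
Qed.

Lemma bu_sum0 : bu_sum P 0 = 1.
Proof. by rewrite /bu_sum big_mkcond big_ord1. Qed.

Lemma bu_sum_odd a : odd a -> bu_sum P a = geom P a.+1.
Proof.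
move=> oa; apply: eq_bigl => k; apply/orP; right.
by apply: contraL oa => /eqP <-; rewrite odd_double.
Qed.

(** Multiplied by P + 1 this reads P^(2m+1) + P^(m+1) + P^m + 1 = (P^(m+1) + 1) (P^m + 1). The
    middle term P^m is removed from the full sum by adding it once more. *)
Lemma bu_sum_even m : (0 < m)%N ->
  bu_sum P m.*2 = (P + 1) * geom P m.+1 * geom P m.
Proof.
move=> m0; apply: (mulfI Q0).
have mm : (m < (m.*2).+1)%N by rewrite ltnS -addnn leq_addr.
have -> : bu_sum P m.*2 = geom P (m.*2).+1 + P ^+ m.
  rewrite /geom (bigD1 (Ordinal mm)) //= addrAC addrr_pchar2 // add0r.
  by apply: eq_bigl => k; rewrite -val_eqE /=; apply/idP/idP; lia.
rewrite mulrDr geomM geomM mulrCA geomM -addnn !exprS exprD; ring.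
Qed.

Lemma bu_sum_1addM a : exists T, bu_sum P a = 1 + P * T.
Proof.
exists (\sum_(k < a | k.+1.*2 != a) P ^+ k).
rewrite /bu_sum big_mkcond big_ord_recl expr0 big_distrr [in RHS]big_mkcond /=.
by congr (_ + _); apply: eq_bigr => i _; rewrite exprS.
Qed.

Lemma coprime_bu_sum a : coprimep P (bu_sum P a).
Proof. by have [T ->] := bu_sum_1addM a; apply: coprimep_1addM. Qed.

Lemma oddpartP n : (0 < n)%N -> exists r u, odd u /\ n = (2 ^ r * u)%N.
Proof.
move=> n0; have [u ou ->] := pfactor_coprime (isT : prime 2) n0.
by exists (logn 2 n), u; rewrite mulnC -coprime2n.
Qed.

(** For odd a, 2^r u is a + 1. For a = 2m, v is the odd one of m and m + 1, and 2^r u is the other;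
    m = 1, where v would be 1, is the separate case a = 2. *)
Lemma bu_sum_cases a : (0 < a)%N ->
  [\/ a = 2%N /\ bu_sum P a = (P + 1) ^+ 2,
      exists r u, [/\ (0 < r)%N, odd u, a = (2 ^ r * u - 1)%N
                    & bu_sum P a = (P + 1) ^+ (2 ^ r - 1) * geom P u ^+ (2 ^ r)]
    | exists r u v, [/\ [/\ (0 < r)%N, odd u, odd v & (1 < v)%N],
          a = (v.-1).*2 /\ (2 ^ r * u)%N = v.-1 \/ a = v.*2 /\ (2 ^ r * u)%N = v.+1
        & bu_sum P a = (P + 1) ^+ (2 ^ r) * geom P v * geom P u ^+ (2 ^ r)]].
Proof.
move=> a0; have [oa|ea] := boolP (odd a).
  have [r [u [ou aE]]] := oddpartP (ltn0Sn a).
  apply: Or32; exists r, u; split=> //; last by rewrite bu_sum_odd // aE geom_pow2.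
    by rewrite lt0n; apply: contraL oa => /eqP r0; rewrite -oddS aE r0 mul1n ou.
  by rewrite -aE subn1.
have aE : a = (a./2).*2 by rewrite -[LHS]odd_double_half (negbTE ea).
move: a0; rewrite {}aE; move: (a./2) => m {a ea}; rewrite double_gt0 => m0.
rewrite bu_sum_even //; have [->|m1] := eqVneq m 1%N.
  by apply: Or31; rewrite geom1 geomSr geom1 expr1; split=> //; ring.
apply: Or33; have expSr r : (P + 1) ^+ (2 ^ r) = (P + 1) * (P + 1) ^+ (2 ^ r - 1).
  by rewrite -exprS -subSn ?expn_gt0 // subn1.
have [om|em] := boolP (odd m).
  have [r [u [ou mE]]] := oddpartP (ltn0Sn m).
  exists r, u, m; rewrite mE geom_pow2 expSr; split; [split=> //| by right | ring].
    by rewrite lt0n; apply: contraL om => /eqP r0; rewrite -oddS mE r0 mul1n ou.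
  by rewrite ltn_neqAle eq_sym m1.
have [r [u [ou mE]]] := oddpartP m0.
exists r, u, m.+1; have -> : geom P m = geom P (2 ^ r * u) by rewrite -mE.
rewrite geom_pow2 expSr; split; [split=> //| by left | ring].
by rewrite lt0n; apply: contra em => /eqP r0; rewrite mE r0 mul1n.
Qed.

Lemma bu_sum_monic a : P \is monic -> bu_sum P a \is monic.
Proof.
move=> mP; have mQ : P + 1 \is monic by rewrite monic_addp1.
have mg n : (0 < n)%N -> geom P n \is monic by case: n => // n _; apply: monic_geom.
have [->|a0] := posnP a; first by rewrite bu_sum0 monic1.
have [[_ ->]|[r [u [_ ou _ ->]]]|[r [u [v [[_ ou ov _] _ ->]]]]] := bu_sum_cases a0;
  by rewrite ?monicMl ?monic_exp ?mg ?odd_gt0.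
Qed.

Lemma size_bu_sum a : (size (bu_sum P a)).-1 = ((size P).-1 * a)%N.
Proof.
have [->|a0] := posnP a; first by rewrite bu_sum0 size_poly1 muln0.
have [oa|ea] := boolP (odd a); first by rewrite bu_sum_odd // size_geom.
have aE : a = (a./2).*2 by rewrite -[LHS]odd_double_half (negbTE ea).
move: a0; rewrite {}aE; move: (a./2) => [|m] {a ea} // _.
rewrite bu_sum_even //.
have g0 n : geom P n.+1 != 0.
  apply/eqP => g0; have := coprime_geom P n; rewrite g0 coprimep0 -size_poly_eq1.
  by case: size sP => [|[]].
rewrite !deg_mul ?mulf_neq0 // size_addp1 // !size_geom.
by rewrite -[X in (X + _ + _)%N]muln1 -!mulnDr; congr (_ * _)%N; lia.
Qed.

Lemma addp1_dvd_bu_sum a : (0 < a)%N -> P + 1 %| bu_sum P a.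
Proof.
move=> a0; have e r : (0 < r)%N -> (0 < 2 ^ r - 1)%N.
  by case: r => // r _; rewrite expnS; have := expn_gt0 2 r; lia.
have [[_ ->]|[r [u [r0 _ _ ->]]]|[r [u [v [[_ _ _ _] _ ->]]]]] := bu_sum_cases a0.
- by rewrite dvdp_exp.
- by rewrite dvdp_mulr // dvdp_exp // e.
- by rewrite -mulrA dvdp_mulr // dvdp_exp // expn_gt0.
Qed.

End Geom.

End Char2.

(** * Polynomials over F_2 of even degree become reducible *)

Section EvenDegree.

Variable F : finFieldType.
Hypothesis char2 : 2%N \in [pchar F].
Implicit Types P Q R S T U V D E A B : {poly F}.

Definition morphF2 : {rmorphism 'F_2 -> F} :=
  GRing.in_alg (pPrimeCharType char2) : {rmorphism 'F_2 -> pPrimeCharType char2}.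

(** The field F_2[x]/(g) has 2^n elements with n = deg g even, so 3 divides the order 2^n - 1 of its
    unit group. Cauchy's theorem gives an element of order 3, a root of x^2 + x + 1, and w is its
    representative of small degree. *)
Lemma irredp_omegaF2 (g : {poly 'F_2}) : g \is monic -> irreducible_poly g ->
  odd (size g) -> exists2 w : {poly 'F_2}, (size w < size g)%N & g %| w ^+ 2 + w + 1.
Proof.
move=> mg ig og; pose K := {poly %/ g with (ig, mg)}.
have dvd3 : (3 %| #|[set: {unit K}]|)%N.
  rewrite card_finField_unit card_qfpoly card_Fp //.
  case: (size g) og => [|n] //= /negbTE en; rewrite -(odd_double_half n) en add0n.
  by rewrite -muln2 mulnC expnM -subn1 -(eqn_mod_dvd) ?expn_gt0 // -modnXm exp1n.
have [x _ ox] := Cauchy (isT : prime 3) dvd3.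
have x1 : (x != 1)%g by apply: contra_eq_neq ox => ->; rewrite order1.
have x3 : val x ^+ 3 = 1 :> K by rewrite -FinRing.val_unitX -ox expg_order.
have /eqP x21 : val x ^+ 2 + val x + 1 == 0 :> K.
  have : (val x - 1) * (val x ^+ 2 + val x + 1) == 0.
    have cube (A : comNzRingType) (v : A) : (v - 1) * (v ^+ 2 + v + 1) = v ^+ 3 - 1 by ring.
    by rewrite cube x3 subrr.
  have val_inj_K : injective (FinRing.uval (R := K)) by apply: val_inj.
  rewrite mulf_eq0 => /orP[] //.
  by rewrite subr_eq0 -FinRing.val_unit1 (inj_eq val_inj_K) (negbTE x1).
have gE : mk_monic g = g by rewrite mk_monicE.
pose y : {poly %/ g} := val x; pose w : {poly 'F_2} := y.
have wE : in_qpoly g w = y.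
  by apply: val_inj; rewrite /= [LHS]in_qpoly_small // size_mk_monic.
have sw : (size w < size (mk_monic g))%N by apply: size_mk_monic.
rewrite gE in sw; exists w => //.
have : in_qpoly g (w ^+ 2 + w + 1) = 0.
  by rewrite !in_qpolyD expr2 in_qpolyM in_qpoly1 wE -expr2; apply: x21.
move/(congr1 val) => /=; rewrite gE => E.
by rewrite dvdpE /Pdiv.Ring.rdvdp; apply/eqP; apply: E.
Qed.

(** A divisor q of g gives the divisor q(P) of g(P), and composition with P multiplies every degree
    by deg P, so proper divisors stay proper. *)
Lemma irredp_map_comp (phi : {rmorphism 'F_2 -> F}) (g : {poly 'F_2}) P :
  (1 < size P)%N -> irreducible_poly (map_poly phi g \Po P) -> irreducible_poly g.
Proof.
move=> sP [sgP igP].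
have sE q : (size (map_poly phi q \Po P)).-1 = ((size q).-1 * (size P).-1)%N.
  by rewrite size_comp_poly size_map_poly.
split=> [|q sq1 qg].
  by have := sE g; case: (size g) => [|[]] //=; case: size sgP => [|[]].
have : (map_poly phi q \Po P) %= (map_poly phi g \Po P).
  apply: igP; last by apply: dvdp_comp_poly; rewrite dvdp_map.
  apply: contra sq1 => /eqP sqP; have := sE q; rewrite sqP /=.
  have q0 : q != 0 by apply: contra_eq_neq sqP => ->; rewrite rmorph0 comp_poly0 size_poly0.
  move: sP q0; rewrite -size_poly_gt0.
  by case: (size q) (size P) => [|[|n]] [|[|p]] //= _ _.
move/eqp_size/(congr1 predn); rewrite !sE => E.
rewrite -dvdp_size_eqp //; move: E.
have g0 : g != 0.
  by apply: contraTneq sgP => ->; rewrite rmorph0 comp_poly0 size_poly0.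
have q0 : q != 0 by apply: contraNneq g0 => q0; rewrite q0 dvd0p in qg.
move: sP q0 g0; rewrite -!size_poly_gt0.
by move: (size q) (size g) (size P) => a b [|[|p]] //= _; nia.
Qed.

(* Modulo an irreducible g over F_2 of even degree there is a primitive cube
   root of unity v in F_2[x]; over F it gives the proper factorization
   v^2 + v + 1 = (v + w) * (v + w + 1) modulo g. *)
Lemma even_degree_reducible (phi : {rmorphism 'F_2 -> F}) (g : {poly 'F_2}) P (w : F) :
    w ^+ 2 + w + 1 = 0 -> g \is monic -> odd (size g) -> (1 < size P)%N ->
  ~ irreducible_poly (map_poly phi g \Po P).
Proof.
move=> w0 mg og sP igP; have ig := irredp_map_comp sP igP.
have [v sv gv] := irredp_omegaF2 mg ig og.
pose vP := map_poly phi v \Po P.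
have dvdM : (map_poly phi g \Po P) %| (vP + w%:P) * (vP + (w + 1)%:P).
  have -> : (vP + w%:P) * (vP + (w + 1)%:P) = map_poly phi (v ^+ 2 + v + 1) \Po P.
    rewrite !(rmorphD, rmorphXn, rmorph1) /= -/vP.
    have := congr1 polyC w0; rewrite !rmorphD rmorphXn rmorph1 rmorph0 /=.
    move: (w%:P) => W; have := pcharf0 (_ : 2%N \in [pchar {poly F}]).
    rewrite pchar_poly => /(_ char2) t0 W0; apply/eqP; rewrite -subr_eq0; apply/eqP.
    rewrite [LHS](_ : _ = (W ^+ 2 + W + 1) + 2 * (vP * W - 1)); last by ring.
    by rewrite W0 t0 mul0r addr0.
  by apply: dvdp_comp_poly; rewrite dvdp_map.
have [sgP _] := igP; have [sg _] := ig.
have sgPE : (size (map_poly phi g \Po P)).-1 = ((size g).-1 * (size P).-1)%N.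
  by rewrite size_comp_poly size_map_poly.
have svPE : (size vP).-1 = ((size v).-1 * (size P).-1)%N.
  by rewrite size_comp_poly size_map_poly.
(* The composite of g with P divides vP + c for a constant c, a polynomial of smaller degree, so v
   is constant. But then v^2 = v in F_2, and g divides v^2 + v + 1 = 1. *)
have v1 : (size v <= 1)%N.
  have dvd_const (c : F) : (map_poly phi g \Po P) %| vP + c%:P -> (size vP <= 1)%N.
    have [|] := eqVneq (vP + c%:P) 0 => [/eqP|n0 /(dvdp_leq n0)].
      by rewrite addr_eq0 -polyCN => /eqP -> _; rewrite size_polyC; case: eqP.
    have := size_polyD vP c%:P; have := size_polyC_leq1 c.
    move: sv svPE sgPE sgP sP; rewrite leqNgt.
    move: (size (vP + _)) (size c%:P) (size vP) (size (_ \Po P)) (size P) (size g) (size v).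
    move=> a b d e [|[|p]] // [|g'] // [|v'] /=; nia.
  have : (size vP <= 1)%N by move: dvdM; rewrite irredp_dvdpM // => /orP[] /dvd_const.
  move: svPE sP; move: (size vP) (size v) (size P) => a [|[|b]] [|[|c]] //=; nia.
move: gv; rewrite (size1_polyC v1); move: (v`_0) => c.
have -> : c%:P ^+ 2 + c%:P + 1 = 1 :> {poly 'F_2}.
  have := expf_card c; rewrite card_Fp // -rmorphXn => ->.
  by rewrite -rmorphD addrr_pchar2 ?add0r ?pchar_Fp.
by rewrite dvdp1 => /eqP sg1; rewrite sg1 in sg.
Qed.

End EvenDegree.

(** * Square roots and separability over F_4 *)

Section FieldF4.

Variable F : finFieldType.
Hypothesis cardF : #|F| = 4%N.
Implicit Types P Q R S T U V D E A B : {poly F}.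

Lemma F4_pchar2 : 2%N \in [pchar F].
Proof. exact: (@card_finPcharP F 2 2). Qed.

Let char2 := F4_pchar2.

Lemma F4_cases (x : F) : [|| x == 0, x == 1 | x ^+ 2 + x + 1 == 0].
Proof.
have : x * (x - 1) * (x ^+ 2 + x + 1) == 0.
  have -> : x * (x - 1) * (x ^+ 2 + x + 1) = x ^+ 4 - x by ring.
  by rewrite -[4%N]cardF expf_card subrr.
by rewrite !mulf_eq0 subr_eq0 orbA.
Qed.

Lemma F4_omega : exists w : F, w ^+ 2 + w + 1 = 0.
Proof.
have [x] : exists x : F, x \notin [:: 0; 1].
  apply/existsP; apply: contraTT isT; rewrite negb_exists => /forallP all01.
  suff : (#|F| <= 2)%N by rewrite cardF.
  rewrite cardE; apply: (@uniq_leq_size _ (enum F) [:: 0; 1]); first exact: enum_uniq.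
  by move=> x _; have := all01 x; rewrite negbK.
rewrite !inE negb_or => /andP[/negbTE x0 /negbTE x1].
by have := F4_cases x; rewrite x0 x1 => /eqP; exists x.
Qed.

(** Each coefficient c is the square of c^2, as c^4 = c, so T arises from P by squaring its
    coefficients. *)
Lemma sqr_compX2 P : exists T, P \Po 'X^2 = T ^+ 2.
Proof.
elim/poly_ind: P => [|P c [T IHP]]; first by exists 0; rewrite comp_poly0 expr0n.
exists (T * 'X + (c ^+ 2)%:P); rewrite comp_polyD comp_polyM comp_polyX comp_polyC IHP.
rewrite -[2%N]/(2 ^ 1)%N exprD_pow2 // expn1 -rmorphXn -exprM -[(2 * 2)%N]cardF expf_card.
by rewrite exprMn.
Qed.

(** If P' = 0, only even powers of X occur in P, and P is a square. *)
Lemma irredp_deriv_neq0 P : irreducible_poly P -> P^`() != 0.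
Proof.
move=> iP; apply/eqP => P'0.
have oP : odd_poly P = 0.
  apply/polyP => i; rewrite coef_odd_poly coef0.
  have := congr1 (fun A : {poly F} => A`_i.*2) P'0; rewrite /= coef_deriv coef0.
  by rewrite mulrS -mulr_natr -mul2n natrM (pcharf0 char2) mul0r mulr0 addr0.
have [T PT] := sqr_compX2 (even_poly P).
have PE : P = T ^+ 2 by rewrite -PT -[LHS]poly_even_odd oP comp_poly0 mul0r addr0.
have [sP iP'] := iP.
have sT : size T != 1%N.
  apply: contraTneq sP => sT; have := size_exp T 2.
  by rewrite -PE sT; case: (size P) => [|[]].
have TP : T %| P by rewrite PE dvdp_exp.
have sTP := eqp_size (iP' T sT TP).
have := size_exp T 2; rewrite -PE -sTP; move: sP; rewrite -sTP.
by case: (size T) => [|[|n]] //= _; lia.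
Qed.

(** Otherwise R divides (P^u + 1)' = P' P^(u-1). Being coprime to P, it divides P', whose degree is
    less than deg P <= deg R. *)
Lemma not_sqr_dvd_expD1 P R u : odd u -> P^`() != 0 -> (size P <= size R)%N ->
  ~ (R ^+ 2 %| P ^+ u + 1).
Proof.
move=> ou P'0 sPR; case/dvdpP => T E.
have cRP : coprimep R P.
  rewrite coprimep_sym; apply: (coprimep_dvdl (_ : R %| P ^+ u + 1)).
    by rewrite E expr2 mulrA dvdp_mull.
  case: u ou E => // u _ _; rewrite exprSr coprimep_addl_mul coprimep1 //.
have : R %| P^`() * P ^+ u.-1.
  have := congr1 deriv E; rewrite derivD deriv_exp -[1]/(1%:P) derivC addr0.
  rewrite mulrn_pchar2 // ou mulr1n => ->.
  rewrite derivM deriv_exp mulrn_pchar2 // mulr0n mulr0 addr0 expr2.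
  by rewrite mulrA dvdp_mull.
rewrite Gauss_dvdpl ?coprimep_expr // => /(dvdp_leq P'0) sRP'.
have := lt_size_deriv (_ : P != 0); rewrite ltnNge (leq_trans sPR) //.
by move=> /(_ _)/negP; apply; [apply: contraNneq P'0 => ->; rewrite deriv0 |].
Qed.

End FieldF4.

(** * Two reducible families: geometric sums and 1 + P^i (P + 1)^j *)

Section Reducibility.

Variable F : finFieldType.
Hypothesis cardF : #|F| = 4%N.
Implicit Types P Q R S T U V D E A B : {poly F}.

Let char2 := F4_pchar2 cardF.

Lemma geom_comp (phi : {rmorphism 'F_2 -> F}) P u :
  geom P u = map_poly phi (geom 'X u) \Po P.
Proof.
rewrite /geom rmorph_sum /= raddf_sum; apply: eq_bigr => i _.
by rewrite /= !rmorphXn /= map_polyX comp_polyX.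
Qed.

Lemma geom_reducible P u : odd u -> (1 < u)%N -> (1 < size P)%N ->
  ~ irreducible_poly (geom P u).
Proof.
move=> ou u1 sP; have phi := morphF2 char2.
have [w w0] := F4_omega cardF; rewrite (geom_comp phi).
have char2F2 : 2%N \in [pchar 'F_2] by rewrite pchar_Fp.
have sX : (1 < size ('X : {poly 'F_2}))%N by rewrite size_polyX.
case: u ou u1 => // u ou u1.
apply: (@even_degree_reducible F char2 phi (geom 'X u.+1) P w w0) => //.
  by rewrite monic_geom // monicX.
have := size_geom char2F2 sX u; rewrite size_polyX mul1n.
by case: (size _) => [|s] /= E; [rewrite -E in u1 | rewrite E].
Qed.

(** The polynomial X^i (X + 1)^j + 1 has coefficients in F_2 and the even degree i + j. This
    excludes a prime S with S + 1 = P^i (P + 1)^j and both exponents odd. *)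
Lemma odd_odd_reducible P i j : odd i -> odd j -> (1 < size P)%N ->
  ~ irreducible_poly (1 + P ^+ i * (P + 1) ^+ j).
Proof.
move=> oi oj sP; have phi := morphF2 char2.
have [w w0] := F4_omega cardF.
pose g : {poly 'F_2} := 'X ^+ i * ('X + 1) ^+ j + 1.
have -> : 1 + P ^+ i * (P + 1) ^+ j = map_poly phi g \Po P.
  rewrite /g !(rmorphD, rmorphM, rmorphXn, rmorph1) /= map_polyX.
  by rewrite comp_polyX addrC.
have sX : (1 < size ('X : {poly 'F_2}))%N by rewrite size_polyX.
have mX1 : ('X + 1 : {poly 'F_2}) \is monic by rewrite monic_addp1 // monicX.
have [G mG [sG gE]] : exists2 G, G \is monic & (size G).-1 = (i + j)%N /\ g = G + 1.
  exists ('X ^+ i * ('X + 1) ^+ j); first by rewrite monicMl monic_exp // monicX.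
  split=> //.
  rewrite deg_mul ?expf_neq0 ?monic_neq0 ?monicX // !size_exp size_addp1 //.
  by rewrite size_polyX !mul1n.
have sG1 : (1 < size G)%N by have := odd_gt0 oi; move: (size G) sG => s; lia.
apply: (@even_degree_reducible F char2 phi g P w w0) => //; rewrite gE.
  by rewrite monic_addp1.
by rewrite size_addp1 // -(prednK (ltnW sG1)) sG /= oddD oi oj.
Qed.

End Reducibility.

(** * Geometric sums that are products of two primes *)

Section GeomFactorization.

Variable F : finFieldType.
Hypothesis cardF : #|F| = 4%N.
Implicit Types P Q R S T U V D E A B : {poly F}.

Let char2 := F4_pchar2 cardF.

Let char2p : 2%N \in [pchar {poly F}].
Proof. by rewrite pchar_poly. Qed.

(** Reduces an identity in characteristic 2 to one that [ring] proves over any commutative ring: T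
    is half of the formal difference of the two sides. *)
Lemma eq_pchar2 P Q T : P = Q + 2 * T -> P = Q.
Proof. by rewrite (pcharf0 char2p) mul0r addr0. Qed.

Lemma addKp P Q : P = Q + 1 -> P + 1 = Q.
Proof. by move=> ->; rewrite GRing.addrK_pchar2. Qed.

Lemma deriv_addp1 P : (P + 1)^`() = P^`().
Proof. by rewrite derivD -[1]/(1%:P) derivC addr0. Qed.

Lemma mulr_deriv_exp P n : P * (P ^+ n)^`() = P^`() * P ^+ n *+ n.
Proof.
rewrite deriv_exp; case: n => [|n]; first by rewrite !mulr0n mulr0.
by rewrite mulrnAr mulrCA -exprS.
Qed.

(** This is the logarithmic derivative T'/T = P' (i/P + j/(P + 1)) with denominators cleared. In
    characteristic 2 the last factor depends only on the parities of i and j. *)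
Lemma mulr_deriv_mul P i j (T := P ^+ i * (P + 1) ^+ j) :
  P * (P + 1) * T^`() = P^`() * T * ((P + 1) *+ i + P *+ j).
Proof.
rewrite /T derivM mulrDr [P * _ * (_ * _)]mulrACA mulr_deriv_exp.
rewrite [P * _ * _]mulrACA mulr_deriv_exp deriv_addp1.
ring.
Qed.

(** Here deg S = (i + j) deg P, and i + j <= 1 would make S equal to 0, P or P + 1. *)
Lemma size_1addM P S i j : P \is monic -> irreducible_poly P -> irreducible_poly S ->
  S != P -> S != P + 1 -> S + 1 = P ^+ i * (P + 1) ^+ j -> (size P < size S)%N.
Proof.
move=> mP iP iS SP SQ E; have [sP _] := iP; have [sS _] := iS.
have := congr1 (fun A : {poly F} => (size A).-1) E.
rewrite size_addp1 // deg_mul ?expf_neq0 ?monic_neq0 ?monic_addp1 // !size_exp.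
rewrite size_addp1 // -mulnDr.
case: i j E => [|[|i]] [|[|j]].
- rewrite !expr0 mulr1 -[X in _ = X]add0r => /addIr S0.
  by move: sS; rewrite S0 size_poly0.
- by rewrite mul1r expr1 => /addIr SP'; rewrite SP' eqxx in SP.
- by move=> _; move: sP sS; move: (size P) (size S) => p s; nia.
- by rewrite mulr1 expr1 => /esym/addKp SP'; rewrite SP' eqxx in SQ.
all: by move=> _; move: sP sS; move: (size P) (size S) => p s; nia.
Qed.

(** The variables are the degrees of P, S, S', P' and the exponent u in the derivative identity for
    R = S + 1. From p (n - 3) <= s' < s = p (n - 1) / 2 follows n < 5. *)
Lemma degree_bound p s s' p' n : (0 < p)%N -> (0 < s)%N -> (s + s)%N = (p * n.-1)%N ->
  odd n -> (1 < n)%N -> (s' <= s.-1)%N -> (p + s' = p' + p * n.-2)%N -> n = 3%N.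
Proof.
case: n => [|[|[|[|[|n]]]]] //= p0 s0 + _ _; rewrite !mulnS.
by move: (p * n)%N => x; lia.
Qed.

Section GeomFactors.

Variables (P R S : {poly F}) (u : nat).
Hypotheses (mP : P \is monic) (mR : R \is monic) (mS : S \is monic).
Hypotheses (iP : irreducible_poly P) (iQ : irreducible_poly (P + 1)).
Hypotheses (iR : irreducible_poly R) (iS : irreducible_poly S).
Hypotheses (uPQRS : uniq [:: P; P + 1; R; S]).
Hypotheses (ou : odd u) (u1 : (1 < u)%N).

Let sP : (1 < size P)%N. Proof. by case: iP. Qed.
Let sR : (1 < size R)%N. Proof. by case: iR. Qed.
Let sS : (1 < size S)%N. Proof. by case: iS. Qed.
Let mQ : P + 1 \is monic. Proof. by rewrite monic_addp1. Qed.

(** Coprimality removes P and P + 1, the derivative bounds the exponents of R and S by 1, and a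
    polynomial that is neither constant nor irreducible needs both. *)
Lemma geom_dvd4 a b c d :
    ((0 < c)%N -> (size P <= size R)%N) -> ((0 < d)%N -> (size P <= size S)%N) ->
    geom P u %| P ^+ a * (P + 1) ^+ b * R ^+ c * S ^+ d ->
  [/\ geom P u = R * S, (0 < c)%N & (0 < d)%N].
Proof.
move=> cPR cPS; have gM := geomM char2 P u.
have u0 : (0 < u)%N := ltnW u1.
have mg : geom P u \is monic by rewrite -(prednK u0) monic_geom.
case/(dvdp_irred4 (And4 mP mQ mR mS) (And4 iP iQ iR iS) mg) => i [j [k [l]]].
case=> ia jb kc ld gE.
have cPg : coprimep P (geom P u) by rewrite -(prednK u0) coprime_geom.
have cQg : coprimep (P + 1) (geom P u) by rewrite coprime_addp1_geom.
have i0 : i = 0%N.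
  case: i {ia} gE => // i gE; move: cPg; rewrite gE exprS -!mulrA coprimepMr coprimepp.
  by rewrite gtn_eqF.
have j0 : j = 0%N.
  case: j {jb} gE => // j gE; move: cQg; rewrite gE exprS i0 mul1r -!mulrA coprimepMr coprimepp.
  by rewrite gtn_eqF // size_addp1.
move: gE; rewrite i0 j0 !mul1r => gE.
have P'0 := irredp_deriv_neq0 cardF iP.
have le1 T (sPT : (size P <= size T)%N) n : T ^+ n %| geom P u -> (n <= 1)%N.
  move=> Tg; rewrite leqNgt; apply/negP => n2.
  apply: (not_sqr_dvd_expD1 cardF ou P'0 sPT); rewrite -gM dvdp_mull //.
  by apply: dvdp_trans Tg; rewrite dvdp_exp2l.
have k1 : (k <= 1)%N.
  have [->//|k0] := posnP k; apply: (le1 R); last by rewrite gE dvdp_mulr.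
  by apply: cPR; apply: leq_trans kc.
have l1 : (l <= 1)%N.
  have [->//|l0] := posnP l; apply: (le1 S); last by rewrite gE dvdp_mull.
  by apply: cPS; apply: leq_trans ld.
have ng : ~ irreducible_poly (geom P u) by apply: geom_reducible.
case: k k1 kc gE => [|[|//]] _ kc; case: l l1 ld => [|[|//]] _ ld gE.
- have := size_geom char2 sP u.-1; rewrite (prednK u0) gE mulr1 size_poly1.
  move/esym/eqP; rewrite muln_eq0; move: sP u1.
  by case: (size P) => [|[|p]] //; case: (u) => [|[|v]].
- by case: ng; rewrite gE mul1r expr1.
- by case: ng; rewrite gE mulr1 expr1.
- by split.
Qed.

Hypothesis gRS : geom P u = R * S.

Let u0 : (0 < u)%N. Proof. exact: ltnW. Qed.

Let QRS : (P + 1) * (R * S) = P ^+ u + 1. Proof. by rewrite -gRS geomM. Qed.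

(** The derivative of (P + 1) R S = P^u + 1, multiplied by P so that P^u can be replaced by 1 + (P +
    1) R S and u disappears. The terms P (P + 1) R' and P (P + 1) S' have the shape of
    [mulr_deriv_mul]. *)
Lemma geom_deriv :
  P * P^`() * (R * S) + (P * (P + 1) * R^`()) * S + (P * (P + 1) * S^`()) * R =
  P^`() * (1 + (P + 1) * (R * S)).
Proof.
have := congr1 (fun A => P * deriv A) QRS.
rewrite !(derivM, deriv_addp1) mulr_deriv_exp mulrn_pchar2 // ou mulr1n.
have -> : P ^+ u = 1 + (P + 1) * (R * S).
  by rewrite QRS [RHS]addrC GRing.addrK_pchar2.
by move=> <-; ring.
Qed.

Lemma irredp_root_size T (x : F) : irreducible_poly T -> root T x -> size T = 2%N.
Proof.
move=> [_ iT]; rewrite root_factor_theorem => xT.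
by rewrite -(eqp_size (iT _ _ xT)) size_XsubC.
Qed.

(** With R' = S' and R + S = 1 the derivative identity collapses to (P + 1) S' = P' [geom P u.-1],
    and the degrees leave only u = 3. *)
Lemma geom_succ_eq3 : R = S + 1 -> u = 3%N.
Proof.
move=> RE; have sg := size_geom char2 sP u.-1.
have sRS : (size R).-1 = (size S).-1 by rewrite RE size_addp1.
rewrite (prednK u0) gRS deg_mul ?monic_neq0 // sRS in sg.
have D : (P + 1) * S^`() = P^`() * geom P u.-1.
  apply: (mulfI (monic_neq0 mP)); have := geom_deriv.
  rewrite {2}RE deriv_addp1 -gRS => E.
  have g1 : geom P u = 1 + P * geom P u.-1 by rewrite -geomS prednK.
  have -> : P * ((P + 1) * S^`()) = P * P^`() * geom P u + (P * (P + 1) * S^`() * S +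
      P * (P + 1) * S^`() * R) + P * P^`() * geom P u.
    rewrite RE; apply: (eq_pchar2 (T := - (P * P^`() * geom P u + P * (P + 1) * S^`() * S))).
    ring.
  rewrite addrA E g1; apply: (eq_pchar2 (T := P^`() * (1 + P + P ^+ 2 * geom P u.-1))).
  by ring.
have P'0 := irredp_deriv_neq0 cardF iP.
have gu0 : geom P u.-1 != 0.
  by case: (u) u1 => [|[|v]] // _; rewrite monic_neq0 // monic_geom.
have S'0 : S^`() != 0.
  apply: contra_neq (mulf_neq0 P'0 gu0); rewrite -D => ->; exact: mulr0.
have := congr1 (fun A : {poly F} => (size A).-1) D.
rewrite deg_mul ?(monic_neq0 mQ) // deg_mul // size_addp1 //.
have := size_geom char2 sP u.-2.
have -> : u.-2.+1 = u.-1 by case: (u) u1 => [|[]].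
move=> ->; have sS' : ((size S^`()).-1 <= (size S).-2)%N.
  have := lt_size_deriv (monic_neq0 mS).
  by case: (size S) sS => [|[|s]] // _; case: (size _).
move: sS'; apply: (degree_bound _ _ sg ou u1).
  by case: (size P) sP => [|[]].
by case: (size S) sS => [|[]].
Qed.

(* The factors with R = S + 1 are P + w and P + w + 1 for a primitive cube
   root of unity w, and one of P, P + 1, P + w, P + w + 1 vanishes at 0. *)
Lemma geom_succ_size2 : R = S + 1 -> size P = 2%N /\ size S = 2%N.
Proof.
move=> RE; have [w w0] := F4_omega cardF.
have [c c0 SE] : exists2 c : F, c ^+ 2 + c + 1 = 0 & S = P + c%:P.
  (* The relation 1 + P + P^2 = S (S + 1) says that P + S is a root of X^2 + X + 1, hence w or w +
     1. *)
  have : (P + S + w%:P) * (P + S + (w + 1)%:P) == 0.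
    have := gRS; rewrite RE (geom_succ_eq3 RE) !geomS geom0 // => E.
    have := congr1 polyC w0; rewrite !rmorphD rmorphXn rmorph1 rmorph0 /= => W0.
    move: (w%:P) W0 => W W0; apply/eqP.
    have -> : (P + S + W) * (P + S + (W + 1)) = (W ^+ 2 + W + 1) + (S + 1) * S +
        (1 + P * (1 + P * (1 + P * 0))) + 2 * (P * S + P * W + S * W - 1) by ring.
    rewrite W0 E; apply: (eq_pchar2 (T := (S + 1) * S + P * S + P * W + S * W - 1)); ring.
  rewrite mulf_eq0 => /orP[] /eqP E; [exists w | exists (w + 1)] => //.
  - by apply/esym/(addr_eq0_pchar2 char2); rewrite -E; ring.
  - have -> : (w + 1) ^+ 2 + (w + 1) + 1 = (w ^+ 2 + w + 1) + 2 * (w + 1) by ring.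
    by rewrite w0 (pcharf0 char2) mul0r addr0.
  - by apply/esym/(addr_eq0_pchar2 char2); rewrite -E; ring.
have sSP : size S = size P by rewrite SE size_polyDl // (leq_ltn_trans (size_polyC_leq1 _)).
suff [T [sT iT rT]] : exists T, [/\ size T = size P, irreducible_poly T & root T 0].
  by rewrite sSP -sT (irredp_root_size iT rT).
have /or3P[] := F4_cases cardF P.[0].
- by exists P.
- move=> /eqP P0; exists (P + 1); rewrite size_addp1 //; split=> //.
  by rewrite /root hornerD P0 hornerC addrr_pchar2.
move/eqP => x0.
have : (P.[0] + c) * (P.[0] + (c + 1)) == 0.
  have -> : (P.[0] + c) * (P.[0] + (c + 1)) = (P.[0] ^+ 2 + P.[0] + 1) +
      (c ^+ 2 + c + 1) + 2 * (P.[0] * c - 1) by ring.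
  by rewrite x0 c0 (pcharf0 char2) mul0r !addr0.
rewrite mulf_eq0 => /orP[] rT; [exists S | exists R]; split=> //.
- by rewrite SE /root hornerD hornerC.
- by rewrite RE size_addp1.
- by rewrite RE SE /root !hornerE -addrA.
Qed.

Let neqPQRS : [/\ S != P, S != P + 1, R != P & R != P + 1].
Proof.
move: uPQRS; rewrite /= !inE !negb_or => /and4P[/and3P[_ PR PS] /andP[QR QS] _ _].
by rewrite ![_ == P]eq_sym ![_ == P + 1]eq_sym.
Qed.

Lemma parity_coeff i j : (P + 1) *+ i + P *+ j =
  if odd i then if odd j then 1 else P + 1 else if odd j then P else 0.
Proof.
rewrite mulrn_pchar2 // [P *+ j]mulrn_pchar2 //.
case: (odd i) (odd j) => [] []; rewrite ?mulr1n ?mulr0n ?addr0 ?add0r //.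
by rewrite addrAC addrr_pchar2 // add0r.
Qed.

Lemma size_parity_coeff (b1 b2 : bool) :
  (size ((if b1 then if b2 then 1 else P + 1 else if b2 then P else 0) : {poly F})%R
    <= size P)%N.
Proof.
by case: b1 b2 => [] []; rewrite ?size_poly1 ?size_poly0 ?size_addp1 // ltnW.
Qed.

(** If l > 0, then R is 1 modulo S, and the derivative identity modulo S shows that S divides P' (1
    + k), where k in {0, 1, P, P + 1} is the parity coefficient of S + 1. As deg S > deg P, only k =
    1 remains; then i and j are odd and S is reducible. *)
Lemma geom_unmixed i j A l : S + 1 = P ^+ i * (P + 1) ^+ j -> R + 1 = A * S ^+ l -> l = 0%N.
Proof.
move=> SE; have [SP SQ _ _] := neqPQRS; case: l => // l RE.
have sPS := size_1addM mP iP iS SP SQ SE.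
have PQS' : P * (P + 1) * S^`() = P^`() * (S + 1) * ((P + 1) *+ i + P *+ j).
  by rewrite -deriv_addp1 SE mulr_deriv_mul.
have := geom_deriv; rewrite PQS' parity_coeff; set k := if odd i then _ else _ => E.
have : S %| P^`() * (1 + k).
  have -> : P^`() * (1 + k) = S * (P * P^`() * R + P * (P + 1) * R^`() + P^`() * k * R +
     P^`() * (P + 1) * R) + P^`() * k * (R + 1).
    apply: (eq_pchar2 (T := - (P^`() * (P + 1) * (R * S)))).
    have -> : P^`() * (1 + k) = P^`() * (1 + (P + 1) * (R * S)) -
        P^`() * (P + 1) * (R * S) + P^`() * k by ring.
    by rewrite -E; ring.
  rewrite RE exprS; apply: dvdp_add; first exact: dvdp_mulIl.
  by rewrite mulrA mulrCA dvdp_mulIl.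
rewrite irredp_dvdpM // => /orP[].
  move/(dvdp_leq (irredp_deriv_neq0 cardF iP)).
  have := lt_size_deriv (monic_neq0 mP).
  by move=> sP'; rewrite leqNgt (ltn_trans sP' sPS).
have nS T : T != 0 -> (size T <= size P)%N -> S %| T -> False.
  by move=> T0 sT /(dvdp_leq T0); rewrite leqNgt (leq_ltn_trans sT sPS).
have sP1 : (1 <= size P)%N by apply: ltnW.
rewrite /k; case oi : (odd i); case oj : (odd j).
- move=> _; case: (odd_odd_reducible cardF oi oj sP).
  by rewrite -SE addrC GRing.addrK_pchar2.
- by rewrite addrCA addrr_pchar2 // addr0 => /nS; case; rewrite ?monic_neq0.
- by rewrite addrC => /nS; case; rewrite ?monic_neq0 ?size_addp1.
- by rewrite addr0 => /nS; case; rewrite ?oner_neq0 ?size_poly1.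
Qed.

(** With k and k' the parity coefficients of S + 1 and R + 1, the derivative identity becomes R S (1
    + k + k') = 1 + S k' + R k. Both k and k' have degree at most deg P, less than deg R and deg S,
    so the right side has degree below deg (R S) and both sides vanish. *)
Lemma geom_parity i j i' j' :
    S + 1 = P ^+ i * (P + 1) ^+ j -> R + 1 = P ^+ i' * (P + 1) ^+ j' ->
  [/\ odd i, ~~ odd j & R * (P + 1) = S * P + 1] \/
  [/\ odd i', ~~ odd j' & S * (P + 1) = R * P + 1].
Proof.
move=> SE RE; have [SP SQ RP RQ] := neqPQRS; have sPS := size_1addM mP iP iS SP SQ SE.
have sPR := size_1addM mP iP iR RP RQ RE.
have PQS' : P * (P + 1) * S^`() = P^`() * (S + 1) * ((P + 1) *+ i + P *+ j).
  by rewrite -deriv_addp1 SE mulr_deriv_mul.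
have PQR' : P * (P + 1) * R^`() = P^`() * (R + 1) * ((P + 1) *+ i' + P *+ j').
  by rewrite -deriv_addp1 RE mulr_deriv_mul.
have := geom_deriv; rewrite PQS' PQR' !parity_coeff.
set k := if odd i then _ else _; set k' := if odd i' then _ else _ => E.
have {}E : R * S * (1 + k + k') = 1 + S * k' + R * k.
  apply: (mulfI (irredp_deriv_neq0 cardF iP)).
  apply: (eq_pchar2 (T := P^`() * (R * S - S * k' - R * k))).
  have -> : P^`() * (1 + S * k' + R * k) = P^`() * (1 + (P + 1) * (R * S)) -
      P^`() * (P + 1) * (R * S) + P^`() * (S * k' + R * k) by ring.
  by rewrite -E; ring.
have k0 : 1 + k + k' = 0.
  apply/eqP; apply: contraTT isT => k0.
  have sk : (size k <= size P)%N by apply: size_parity_coeff.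
  have sk' : (size k' <= size P)%N by apply: size_parity_coeff.
  have := congr1 (fun A : {poly F} => (size A).-1) E.
  have [R0 S0] := (monic_neq0 mR, monic_neq0 mS).
  rewrite deg_mul ?mulf_neq0 // deg_mul // => sE.
  have sM (T c : {poly F}) : (size c <= size P)%N -> (size (T * c)%R <= (size T + size P).-1)%N.
    move=> sc; apply: leq_trans (size_polyMleq _ _) _.
    by rewrite -!subn1 leq_sub2r // leq_add2l.
  have := sM S _ sk'; have := sM R _ sk; have := size_polyD (1 + S * k') (R * k).
  have := size_polyD 1 (S * k'); rewrite size_poly1 -/k -/k'.
  move: sE sP sPS sPR.
  move: (size (1 + S * k')) (size (R * k)) (size (S * k')) (size (1 + S * k' + _)).
  move: (size P) (size R) (size S) (size (1 + k + k')).-1.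
  by clear; lia.
move: E; rewrite k0 mulr0 => /esym E.
have [P0 Q0] := (monic_neq0 mP, monic_neq0 mQ).
have S1 : S != 1 by apply: contraTneq sS => ->; rewrite size_poly1.
have R1 : R != 1 by apply: contraTneq sR => ->; rewrite size_poly1.
(* The condition k + k' = 1 leaves {0, 1}, which would give R = 1 or S = 1, and {P, P + 1}, which
   gives the two conclusions. *)
move: k0 E; rewrite /k /k'; case oi : (odd i); case oj : (odd j);
  case oi' : (odd i'); case oj' : (odd j') => k0.
- by case/eqP: (oner_neq0 {poly F}); rewrite -k0; apply: (eq_pchar2 (T := -1)); ring.
- by case/eqP: Q0; rewrite -k0; apply: (eq_pchar2 (T := -1)); ring.
- by case/eqP: P0; rewrite -k0; apply: (eq_pchar2 (T := -1)); ring.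
- move=> E; case/eqP: R1; rewrite -[RHS]addr0 -E.
  by apply: (eq_pchar2 (T := -1)); ring.
- by case/eqP: Q0; rewrite -k0; apply: (eq_pchar2 (T := -1)); ring.
- by case/eqP: (oner_neq0 {poly F}); rewrite -k0; apply: (eq_pchar2 (T := - 1 - P)); ring.
- move=> E; left; split=> //; apply: (addr_eq0_pchar2 char2); rewrite -E; ring.
- by case/eqP: P0; rewrite -k0; apply: (eq_pchar2 (T := -1)); ring.
- by case/eqP: P0; rewrite -k0; apply: (eq_pchar2 (T := -1)); ring.
- move=> E; right; split=> //; apply: (addr_eq0_pchar2 char2); rewrite -E; ring.
- by case/eqP: (oner_neq0 {poly F}); rewrite -k0; apply: (eq_pchar2 (T := - P)); ring.
- by case/eqP: Q0; rewrite -k0; ring.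
- move=> E; case/eqP: S1; rewrite -[RHS]addr0 -E.
  by apply: (eq_pchar2 (T := -1)); ring.
- by case/eqP: P0; rewrite -k0; apply: (eq_pchar2 (T := -1)); ring.
- by case/eqP: Q0; rewrite -k0; ring.
- by case/eqP: (oner_neq0 {poly F}); rewrite -k0; ring.
Qed.

(** With T = S + 1, eliminating R gives P + P T^2 + T = P^u. Divisibility by P^2 forces i = 1, the
    degrees give u = 2j + 3, and the multiplicity of P + 1 then forces j = 2. *)
Lemma geom_seven i j :
    S + 1 = P ^+ i * (P + 1) ^+ j -> odd i -> ~~ odd j -> R * (P + 1) = S * P + 1 ->
  [/\ u = 7%N, S = P ^+ 3 + P + 1 & R = P ^+ 3 + P ^+ 2 + 1].
Proof.
move=> SE oi ej RE; have [SP SQ _ _] := neqPQRS.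
have [P0 Q0] := (monic_neq0 mP, monic_neq0 mQ).
have S_eq : S = P ^+ i * (P + 1) ^+ j + 1 by rewrite -SE GRing.addrK_pchar2.
pose T := P ^+ i * (P + 1) ^+ j.
have H : P + P * T ^+ 2 + T = P ^+ u.
  have : (S * P + 1) * S = P ^+ u + 1 by rewrite -QRS -RE; ring.
  move/addKp => <-; rewrite S_eq -/T.
  by apply: (eq_pchar2 (T := - (P * T + 1))); ring.
have i1 : i = 1%N.
  case: (ltnP 1 i) => [i2|]; last by case: (i) oi => [|[]].
  have : P ^+ 2 %| P ^+ 1.
    have -> : P ^+ 1 = P ^+ u + P * T ^+ 2 + T.
      by rewrite expr1 -H; apply: (eq_pchar2 (T := - (P * T ^+ 2 + T))); ring.
    have PT : P ^+ 2 %| T by rewrite dvdp_mulr // dvdp_exp2l.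
    by rewrite !dvdp_add ?dvdp_exp2l // mulrC expr2 -mulrA dvdp_mulr.
  by rewrite dvdp_Pexp2l.
have H2 : 1 + P ^+ 2 * (P + 1) ^+ (j + j) + (P + 1) ^+ j = P ^+ u.-1.
  apply: (mulfI P0); rewrite -exprS prednK // -H /T i1 exprD; ring.
have j0 : (0 < j)%N.
  rewrite lt0n; apply: contraNneq SQ => j0; move: S_eq.
  by rewrite i1 j0 => ->; rewrite mulr1 expr1.
have uE : u.-1 = (2 + (j + j))%N.
  have := congr1 (fun A : {poly F} => (size A).-1) H2.
  have sH : (size (P ^+ 2 * (P + 1) ^+ (j + j))).-1 = ((size P).-1 * (2 + (j + j)))%N.
    by rewrite deg_mul ?expf_neq0 // !size_exp size_addp1 // -mulnDr.
  have sQ : (size ((P + 1) ^+ j)).-1 = ((size P).-1 * j)%N by rewrite size_exp size_addp1.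
  have sm : (size (1 + (P + 1) ^+ j)%R < size (P ^+ 2 * (P + 1) ^+ (j + j))%R)%N.
    apply: leq_ltn_trans (size_polyD _ _) _; rewrite size_poly1.
    move: sH sQ; rewrite !mulnDr gtn_max.
    move: (size (P ^+ 2 * _)%R) (size ((P + 1) ^+ j)%R) (size P) sP => a b p.
    by clear; move: (p.-1 * j)%N => x; lia.
  have -> : 1 + P ^+ 2 * (P + 1) ^+ (j + j) + (P + 1) ^+ j =
      P ^+ 2 * (P + 1) ^+ (j + j) + (1 + (P + 1) ^+ j) by ring.
  rewrite size_polyDl // sH size_exp => /eqP.
  by rewrite eqn_pmul2l; [move/eqP | case: (size P) sP => [|[]]].
(* Both sides are P^(u-1) + 1, with u - 1 = 2 (j + 1). On the right P + 1 occurs exactly twice, as j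
   + 1 is odd; on the left at least j times. *)
have H3 : (P + 1) ^+ j * (P ^+ 2 * (P + 1) ^+ j + 1) = ((P + 1) * geom P j.+1) ^+ 2.
  have sqrD1 A : (A + 1) ^+ 2 = A ^+ 2 + 1 by apply: (eq_pchar2 (T := A)); ring.
  rewrite geomM // sqrD1 -exprM muln2.
  have -> : j.+1.*2 = u.-1 by rewrite uE -addnn addnS addSn.
  by rewrite -H2; apply: (eq_pchar2 (T := -1)); rewrite exprD; ring.
have j2 : j = 2%N.
  have [j2|j2] := leqP j 2; first by case: (j) j0 j2 ej => [|[|[|]]].
  move: H3; rewrite -(subnKC (ltnW j2)) exprD exprMn -mulrA => /(mulfI (expf_neq0 2 Q0)) H3.
  have : P + 1 %| geom P j.+1.
    apply: (irredp_dvdpX (n := 2)) => //; rewrite -{1}(subnKC (ltnW j2)) -H3.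
    by rewrite dvdp_mulr // dvdp_exp // subn_gt0.
  have : coprimep (P + 1) (geom P j.+1) by rewrite coprime_addp1_geom.
  by rewrite irreducible_poly_coprime // => /negP.
have u7 : u = 7%N by rewrite -(prednK u0) uE j2.
have SE' : S = P ^+ 3 + P + 1.
  by rewrite S_eq i1 j2; apply: (eq_pchar2 (T := P ^+ 2)); ring.
split=> //; apply: (mulIf Q0); rewrite RE SE'.
by apply: (eq_pchar2 (T := - P ^+ 3)); ring.
Qed.

End GeomFactors.

End GeomFactorization.

(** For these exponents [bu_sum P a] is the pure power (P + 1)^a; n = 0 admits the exponent 0. *)
Definition split_exponent a := a = 2%N \/ exists n, a = (2 ^ n - 1)%N.

(** The pairs (xa, ya) and (xb, yb) are the exponents of [geom P 7] = R S and of the linear shift in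
    the sums for P^a and (P + 1)^b. The three equations compare the exponents of P, P + 1 and R, the
    terms 3 * c coming from (R + 1)^c (S + 1)^c = P^(3c) (P + 1)^(3c). *)
Lemma cubic_exponents a b c xa ya xb yb : (0 < c)%N -> split_exponent c ->
   [\/ [/\ a = 2, ya = 2 & xa = 0]%N, [/\ a = 14, ya = 8 & xa = 1]%N,
       exists2 r, (0 < r)%N & [/\ a = 2 ^ r - 1, ya = 2 ^ r - 1 & xa = 0]%N
     | exists2 r, (0 < r)%N & [/\ a = 7 * 2 ^ r - 1, ya = 2 ^ r - 1 & xa = 2 ^ r]%N] ->
   [\/ [/\ b = 2, yb = 2 & xb = 0]%N, [/\ b = 14, yb = 8 & xb = 1]%N,
       exists2 r, (0 < r)%N & [/\ b = 2 ^ r - 1, yb = 2 ^ r - 1 & xb = 0]%N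
     | exists2 r, (0 < r)%N & [/\ b = 7 * 2 ^ r - 1, yb = 2 ^ r - 1 & xb = 2 ^ r]%N] ->
   (a = yb + 3 * c)%N -> (b = ya + 3 * c)%N -> c = (xa + xb)%N ->
  (a, b, c) \in [:: (7, 13, 2); (13, 7, 2); (14, 14, 2)]%N.
Proof.
have pow_even r : (0 < r)%N -> exists2 m, (0 < m)%N & (2 ^ r = 2 * m)%N.
  by case: r => // r _; exists (2 ^ r)%N; rewrite ?expnS ?expn_gt0.
(* The number 12 arises from a = 14 and b = 2^r - 1, or the reverse: then c = 1 and 2^r - 1 = 8 +
   3. *)
have pow12 r : (2 ^ r = 12)%N -> False.
  by case: r => [|[|[|[|r]]]] //; rewrite !expnS; have := expn_gt0 2 r; lia.
move=> c0 cs Ha Hb Ea Eb Ec.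
suff [] : [\/ [/\ a = 7, b = 13 & c = 2], [/\ a = 13, b = 7 & c = 2]
  | [/\ a = 14, b = 14 & c = 2]]%N by move=> [-> -> ->].
have cE : c = 2%N \/ c = 1%N \/ odd c && (2 < c)%N.
  case: cs c0 => [-> _|[[|[|n]] -> // _]]; [by left | by right; left|].
  by right; right; rewrite !expnS; have := expn_gt0 2 n; lia.
case: Ha => [[? ? ?]|[? ? ?]|[r r0 [? ? ?]]|[r r0 [? ? ?]]];
case: Hb => [[? ? ?]|[? ? ?]|[r' r0' [? ? ?]]|[r' r0' [? ? ?]]]; subst.
all: try (have [m m0 mE] := pow_even r r0); try (have [m' m0' mE'] := pow_even r' r0').
all: try lia.
all: try (have := pow12 r); try (have := pow12 r'); try lia.
- exact: Or33.
- by move=> _ _; apply: Or31; split; lia.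
- by move=> _ _; apply: Or32; split; lia.
Qed.

(** * How the exponent determines the factors of the sum *)

Section ExponentTypes.

Variable F : finFieldType.
Hypothesis cardF : #|F| = 4%N.
Implicit Types P Q R S T U V D E A B : {poly F}.

Let char2 := F4_pchar2 cardF.

Lemma addp1K P : P + 1 + 1 = P.
Proof. by apply: GRing.addrK_pchar2; rewrite pchar_poly. Qed.

(** By symmetry deg S <= deg R. If R divides S + 1, then R = S + 1 and P, R, S are linear. Otherwise
    k = 0, then l = 0 by [geom_unmixed], and the parity argument applies. *)
Lemma geom_factors P R S u i j k i' j' l :
    [/\ P \is monic, R \is monic & S \is monic] ->
    [/\ irreducible_poly P, irreducible_poly (P + 1), irreducible_poly R
      & irreducible_poly S] ->
    uniq [:: P; P + 1; R; S] -> ~ [/\ size P = 2%N, size R = 2%N & size S = 2%N] ->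
    odd u -> (1 < u)%N -> geom P u = R * S ->
    S + 1 = P ^+ i * (P + 1) ^+ j * R ^+ k -> R + 1 = P ^+ i' * (P + 1) ^+ j' * S ^+ l ->
  u = 7%N /\
  ([/\ R = P ^+ 3 + P + 1 & S = P ^+ 3 + P ^+ 2 + 1] \/
   [/\ S = P ^+ 3 + P + 1 & R = P ^+ 3 + P ^+ 2 + 1]).
Proof.
move=> mPRS iPRS uPRS nl ou u1 gRS.
wlog sSR : R S i j k i' j' l mPRS iPRS uPRS nl gRS / (size S <= size R)%N.
  move=> W SE RE; case/orP: (leq_total (size S) (size R)) => sRS.
    exact: W mPRS iPRS uPRS nl gRS sRS SE RE.
  suff [-> [[? ?]|[? ?]]] : u = 7%N /\
    ([/\ S = P ^+ 3 + P + 1 & R = P ^+ 3 + P ^+ 2 + 1] \/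
     [/\ R = P ^+ 3 + P + 1 & S = P ^+ 3 + P ^+ 2 + 1]).
  - by split=> //; right.
  - by split=> //; left.
  case: mPRS iPRS => mP mR mS [iP iQ iR iS].
  apply: W sRS RE SE => //; last by rewrite mulrC.
    move: uPRS; rewrite /= !inE !negb_or ![S == R]eq_sym.
    by move=> /and4P[/and3P[-> -> ->] /andP[-> ->] -> _].
  by case=> ? ? ?; apply: nl.
case: mPRS iPRS => mP mR mS [iP iQ iR iS].
have [sR sS] : (1 < size R)%N /\ (1 < size S)%N by case: iR iS => ? _ [].
have uPSR : uniq [:: P; P + 1; S; R].
  move: uPRS; rewrite /= !inE !negb_or ![S == R]eq_sym.
  by move=> /and4P[/and3P[-> -> ->] /andP[-> ->] -> _].
have gSR : geom P u = S * R by rewrite mulrC.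
case: k => [|k] SE RE; last first.
  have RS : R = S + 1.
    apply: monic_dvdp_eq => //; rewrite ?monic_addp1 ?size_addp1 //.
    by rewrite SE exprS dvdp_mull // dvdp_mulIl.
  have [sP2 sS2] := geom_succ_size2 cardF mP mR mS iP iQ iR iS ou u1 gRS RS.
  by case: nl; split=> //; rewrite RS size_addp1.
rewrite mulr1 in SE.
have l0 := geom_unmixed cardF mP iP iS uPRS ou gRS SE RE.
rewrite l0 mulr1 in RE.
have [[oi ej E]|[oi ej E]] :=
  geom_parity cardF mP mR mS iP iR iS uPRS ou gRS SE RE.
  have [-> -> ->] := geom_seven cardF mP iP iQ uPRS u1 gRS SE oi ej E.
  by split=> //; right.
have [-> -> ->] := geom_seven cardF mP iP iQ uPSR u1 gSR RE oi ej E.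
by split=> //; left.
Qed.

Lemma bu_sum_split P a : (1 < size P)%N -> split_exponent a ->
  bu_sum P a = (P + 1) ^+ a.
Proof.
move=> sP [->|[n ->]].
  by rewrite (bu_sum_even char2 sP (m := 1)) // geom1 geomSr geom1; ring.
case: n => [|n]; first exact: bu_sum0.
rewrite bu_sum_odd //; last by rewrite oddB ?expn_gt0 // expnS oddM.
rewrite subn1 prednK ?expn_gt0 // -[X in geom P X]muln1 geom_pow2 //.
by rewrite geom1 expr1n mulr1 subn1.
Qed.

Lemma bu_sum_geom P a : (1 < size P)%N -> (0 < a)%N ->
  split_exponent a \/ exists u, [/\ odd u, (1 < u)%N & geom P u %| bu_sum P a].
Proof.
move=> sP a0; have [[->]|[r [u [r0 ou aE ->]]]|] := bu_sum_cases char2 sP a0.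
- by left; left.
- have [u1|u1] := leqP u 1; last first.
    by right; exists u; rewrite dvdp_mull // dvdp_exp // expn_gt0.
  left; right; exists r; rewrite aE.
  by case: u u1 ou {aE} => [|[|]]; rewrite ?muln1.
- move=> [r [u [v [[_ _ ov v1] _ ->]]]]; right; exists v.
  by rewrite mulrAC dvdp_mull.
Qed.

(** For even a > 2 the odd one of a/2 and a/2 + 1 must be 7. This leaves a = 14, with 8 = 2^3 as the
    other one, and a = 12, where 6 = 2 * 3 would bring in [geom P 3]. *)
Lemma bu_sum_geom7 P a : (1 < size P)%N -> (0 < a)%N ->
    (forall u, odd u -> (1 < u)%N -> geom P u %| bu_sum P a -> u = 7%N) ->
  exists x y, bu_sum P a = (P + 1) ^+ y * geom P 7 ^+ x /\
   [\/ [/\ a = 2, y = 2 & x = 0]%N, [/\ a = 14, y = 8 & x = 1]%N,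
       exists2 r, (0 < r)%N & [/\ a = 2 ^ r - 1, y = 2 ^ r - 1 & x = 0]%N
     | exists2 r, (0 < r)%N & [/\ a = 7 * 2 ^ r - 1, y = 2 ^ r - 1 & x = 2 ^ r]%N].
Proof.
move=> sP a0 only7.
have [[aE sE]|[r [u [r0 ou aE sE]]]|[r [u [v [[r0 ou ov v1] aE sE]]]]] :=
  bu_sum_cases char2 sP a0.
- by exists 0%N, 2%N; rewrite sE mulr1; split=> //; apply: Or41.
- have [u1|u1] := leqP u 1.
    have {}u1 : u = 1%N by case: u u1 ou {aE sE} => [|[|]].
    exists 0%N, (2 ^ r - 1)%N; rewrite sE u1 geom1 expr1n; split=> //.
    by apply: Or43; exists r => //; rewrite aE u1 muln1.
  have u7 : u = 7%N.
    by apply: only7 => //; rewrite sE dvdp_mull // dvdp_exp // expn_gt0.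
  exists (2 ^ r)%N, (2 ^ r - 1)%N; rewrite sE u7; split=> //.
  by apply: Or44; exists r => //; rewrite aE u7 mulnC.
- have v7 : v = 7%N by apply: only7 => //; rewrite sE mulrAC dvdp_mull.
  have u17 : u = 1%N \/ u = 7%N.
    have [u1|u1] := leqP u 1; first by left; case: u u1 ou {aE sE} => [|[|]].
    by right; apply: only7 => //; rewrite sE dvdp_mull // dvdp_exp // expn_gt0.
  have e2 : (2 ^ r * u = 8 /\ a = 14)%N.
    move: aE; rewrite v7 => -[[_ /= E]|[-> ->//]].
    exfalso; case: u17 E => ->; case: r r0 {sE} => [|[|[|[|r]]]] //= _; rewrite !expnS; lia.
  have {}u1 : u = 1%N.
    case: u17 e2 => // -> [/(congr1 (fun n => n %% 7)%N)].
    by rewrite modnMl.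
  exists 1%N, 8; rewrite sE v7 u1 geom1 expr1n mulr1 expr1; split.
    by move: e2; rewrite u1 muln1 => -[-> _].
  by apply: Or42; rewrite e2.2.
Qed.

End ExponentTypes.

(** * The case of the two cubics *)

Section CubicFactors.

Variable F : finFieldType.
Hypothesis cardF : #|F| = 4%N.
Implicit Types P Q R S T U V D E A B : {poly F}.

Let char2 := F4_pchar2 cardF.

(** Coprime to P, Q and R, [geom R u] would be a power S^l with l <= 1; but its degree is (u - 1)
    deg S with u - 1 >= 2. *)
Lemma geom_not_dvd P Q R S u a b c d :
    [/\ P \is monic, Q \is monic, R \is monic & S \is monic] ->
    [/\ irreducible_poly P, irreducible_poly Q, irreducible_poly R
      & irreducible_poly S] ->
    P %| R + 1 -> Q %| R + 1 -> size R = size S -> odd u -> (1 < u)%N ->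
  ~ geom R u %| P ^+ a * Q ^+ b * R ^+ c * S ^+ d.
Proof.
move=> mPQRS iPQRS PR QR sRS ou u1 gA.
have [mP mQ mR mS] := mPQRS; have [iP iQ iR iS] := iPQRS.
have [sP sQ] : (1 < size P)%N /\ (1 < size Q)%N by case: iP iQ => ? _ [].
have sR : (1 < size R)%N by case: iR.
have u0 := ltnW u1.
have mg : geom R u \is monic by rewrite -(prednK u0) monic_geom.
have [i [j [k [l [_ _ _ _ gE]]]]] := dvdp_irred4 mPQRS iPQRS mg gA.
have cg T : T %| R + 1 -> coprimep T (geom R u).
  by move=> /coprimep_dvdr; apply; apply: coprime_addp1_geom.
have i0 : i = 0%N.
  case: i gE (cg P PR) => // i ->; rewrite exprS -!mulrA coprimepMr coprimepp.
  by rewrite gtn_eqF.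
have j0 : j = 0%N.
  case: j gE (cg Q QR) => // j ->; rewrite i0 mul1r exprS -!mulrA coprimepMr coprimepp.
  by rewrite gtn_eqF.
have k0 : k = 0%N.
  have : coprimep R (geom R u) by rewrite -(prednK u0) coprime_geom.
  case: k gE => // k ->; rewrite i0 j0 !mul1r exprS -!mulrA coprimepMr coprimepp.
  by rewrite gtn_eqF.
rewrite i0 j0 k0 !mul1r in gE.
have l1 : (l <= 1)%N.
  rewrite leqNgt; apply/negP => l2.
  apply: (@not_sqr_dvd_expD1 _ cardF R S u ou (irredp_deriv_neq0 cardF iR)).
    by rewrite sRS.
  by rewrite -geomM // gE dvdp_mull // dvdp_exp2l.
have := size_geom char2 sR u.-1; rewrite prednK // gE size_exp -sRS => /eqP.
rewrite eqn_pmul2l; last by case: (size R) sR => [|[]].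
by case: l l1 {gE} => [|[|]] // _; case: (u) u1 ou => [|[|[|]]].
Qed.

Lemma geom_inj P u v : (1 < size P)%N -> (0 < u)%N -> (0 < v)%N ->
  geom P u = geom P v -> u = v.
Proof.
move=> sP; case: u v => [|u] [|v] // _ _ /(congr1 (fun A : {poly F} => (size A).-1)).
rewrite !size_geom // => /eqP; rewrite eqn_pmul2l; first by move/eqP->.
by case: (size P) sP => [|[]].
Qed.

Lemma geom7E P : geom P 7 = (P ^+ 3 + P + 1) * (P ^+ 3 + P ^+ 2 + 1).
Proof. by rewrite !geomS geom0; apply: (eq_pchar2 cardF (T := - P ^+ 3)); ring. Qed.

(** The shift P -> P + 1 exchanges the two cubics, so [geom (P + 1) 7] and [geom P 7] coincide. *)
Lemma cubic_addp1 P : (P + 1) ^+ 3 + (P + 1) + 1 = P ^+ 3 + P ^+ 2 + 1.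
Proof. by apply: (eq_pchar2 cardF (T := P ^+ 2 + 2 * P + 1)); ring. Qed.

Lemma cubic_addp1' P : (P + 1) ^+ 3 + (P + 1) ^+ 2 + 1 = P ^+ 3 + P + 1.
Proof. by apply: (eq_pchar2 cardF (T := 2 * P ^+ 2 + 2 * P + 1)); ring. Qed.

(** Since R + 1 and S + 1 are divisible by P and P + 1 and deg R = deg S, the sums for R and S are
    pure powers of R + 1 = P (P + 1)^2 and S + 1 = P^2 (P + 1). Comparing the four exponents turns
    perfection into arithmetic; R and S receive the same exponent xa + xb. *)
Lemma cubic_perfect P R S a b c d : R = P ^+ 3 + P + 1 -> S = P ^+ 3 + P ^+ 2 + 1 ->
    [/\ P \is monic, P + 1 \is monic, R \is monic & S \is monic] ->
    [/\ irreducible_poly P, irreducible_poly (P + 1), irreducible_poly R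
      & irreducible_poly S] ->
    uniq [:: P; P + 1; R; S] ->
    [/\ 0 < a, 0 < b, 0 < c & 0 < d]%N ->
    bu_sum P a * bu_sum (P + 1) b * bu_sum R c * bu_sum S d =
      P ^+ a * (P + 1) ^+ b * R ^+ c * S ^+ d ->
  d = c /\ (a, b, c) \in [:: (7, 13, 2); (13, 7, 2); (14, 14, 2)]%N.
Proof.
move=> R_eq S_eq mPQRS iPQRS uPQRS [a0 b0 c0 d0] E.
have [mP mQ mR mS] := mPQRS; have [iP iQ iR iS] := iPQRS.
have [sP sQ] : (1 < size P)%N /\ (1 < size (P + 1)%R)%N by case: iP iQ => ? _ [].
have [sR sS] : (1 < size R)%N /\ (1 < size S)%N by case: iR iS => ? _ [].
have RE : R + 1 = P * (P + 1) ^+ 2.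
  by rewrite R_eq; apply: (eq_pchar2 cardF (T := 1 - P ^+ 2)); ring.
have SE : S + 1 = P ^+ 2 * (P + 1).
  by rewrite S_eq; apply: (eq_pchar2 cardF (T := 1)); ring.
have [P0 Q0] := (monic_neq0 mP, monic_neq0 mQ).
have dR : (size R).-1 = ((size P).-1 * 3)%N.
  rewrite -(size_addp1 sR) RE deg_mul ?expf_neq0 // size_exp size_addp1 //.
  by rewrite -[X in (X + _)%N]muln1 -mulnDr.
have dS : (size S).-1 = ((size P).-1 * 3)%N.
  rewrite -(size_addp1 sS) SE deg_mul ?expf_neq0 // size_exp size_addp1 //.
  by rewrite -[X in (_ + X)%N]muln1 -mulnDr.
have sRS : size R = size S.
  by rewrite -(prednK (ltnW sR)) -(prednK (ltnW sS)) dR dS.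
have sPR : (size P <= size R)%N.
  by rewrite -(prednK (ltnW sR)) -(prednK (ltnW sP)) dR ltnS leq_pmulr.
have sPS : (size P <= size S)%N by rewrite -sRS.
have [PR QR] : P %| R + 1 /\ P + 1 %| R + 1.
  by rewrite RE dvdp_mulIl dvdp_mull // dvdp_exp.
have [PS QS] : P %| S + 1 /\ P + 1 %| S + 1.
  by rewrite SE dvdp_mulIr dvdp_mulr // dvdp_exp.
have gP7 : geom P 7 = R * S by rewrite geom7E R_eq S_eq.
have gQ7 : geom (P + 1) 7 = R * S.
  by rewrite geom7E cubic_addp1 cubic_addp1' mulrC R_eq S_eq.
have only7P u : odd u -> (1 < u)%N -> geom P u %| bu_sum P a -> u = 7%N.
  move=> ou u1 gP; apply: (geom_inj sP) => //; first exact: ltnW.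
  have [|-> _ _] := @geom_dvd4 _ cardF P R S u mP mR mS iP iQ iR iS ou u1
    a b c d (fun=> sPR) (fun=> sPS); last by rewrite gP7.
  by rewrite -E -!mulrA dvdp_mulr.
have only7Q u : odd u -> (1 < u)%N -> geom (P + 1) u %| bu_sum (P + 1) b -> u = 7%N.
  move=> ou u1 gQ; apply: (geom_inj sQ) => //; first exact: ltnW.
  have iP1 : irreducible_poly (P + 1 + 1) by rewrite addp1K.
  have sQR : (size (P + 1)%R <= size R)%N by rewrite size_addp1.
  have sQS : (size (P + 1)%R <= size S)%N by rewrite size_addp1.
  have [|-> _ _] := @geom_dvd4 _ cardF (P + 1) R S u mQ mR mS iQ iP1 iR iS ou u1
    b a c d (fun=> sQR) (fun=> sQS); last by rewrite gQ7.
  by rewrite addp1K // [(P + 1) ^+ b * _]mulrC -E -!mulrA dvdp_mull // dvdp_mulr.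
have split_R : split_exponent c.
  have [//|[u [ou u1 gu]]] := bu_sum_geom cardF sR c0.
  case: (@geom_not_dvd P (P + 1) R S u a b c d) => //.
  by rewrite -E dvdp_mulr // dvdp_mull.
have split_S : split_exponent d.
  have [//|[u [ou u1 gu]]] := bu_sum_geom cardF sS d0.
  case: (@geom_not_dvd P (P + 1) S R u a b d c) => //.
  by rewrite mulrAC -E dvdp_mull.
have [xa [ya [Ea Ca]]] := bu_sum_geom7 cardF sP a0 only7P.
have [xb [yb [Eb Cb]]] := bu_sum_geom7 cardF sQ b0 only7Q.
move: E; rewrite Ea Eb addp1K // gP7 gQ7 !bu_sum_split // RE SE => E.
have [] := @irred4_inj _ P (P + 1) R S
  (yb + c + (d + d))%N (ya + (c + c) + d)%N (xa + xb)%N (xa + xb)%N a b c d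
  mPQRS iPQRS uPQRS.
  by rewrite -E !exprD !exprMn; ring.
move=> aE bE cE dE; have dc : d = c by rewrite -cE -dE.
split=> //; apply: cubic_exponents Ca Cb _ _ (esym cE) => //.
  by rewrite -aE dc !mulSn addn0 -!addnA.
by rewrite -bE dc !mulSn addn0 -!addnA.
Qed.

End CubicFactors.

(** * Classification of the exponents *)

Section ExponentClassification.

Variable F : finFieldType.
Hypothesis cardF : #|F| = 4%N.
Implicit Types P Q R S T U V D E A B : {poly F}.

Let char2 := F4_pchar2 cardF.

(** Coprime to P, P + 1 and [bu_sum S d], the power S^d divides [bu_sum R c]; likewise R^c divides
    [bu_sum S d]. These sums have degrees c deg R and d deg S, so both divisibilities are
    equalities. For c > 0, R + 1 and S + 1 are then powers S^e and R^f with e f = 1. A factor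
    [geom R u] with u > 1 is impossible, being coprime to R + 1 = S. *)
Lemma split_perfect P R S a b c d :
    [/\ P \is monic, P + 1 \is monic, R \is monic & S \is monic] ->
    [/\ irreducible_poly P, irreducible_poly (P + 1), irreducible_poly R
      & irreducible_poly S] ->
    uniq [:: P; P + 1; R; S] -> split_exponent a -> split_exponent b ->
    bu_sum P a * bu_sum (P + 1) b * bu_sum R c * bu_sum S d =
      P ^+ a * (P + 1) ^+ b * R ^+ c * S ^+ d ->
  a = b /\ (c = 0%N /\ d = 0%N \/ [/\ c = d, split_exponent c & S = R + 1]).
Proof.
move=> mPQRS iPQRS uPQRS sa sb E.
have [mP mQ mR mS] := mPQRS; have [iP iQ iR iS] := iPQRS.
have [sP sQ] : (1 < size P)%N /\ (1 < size (P + 1)%R)%N by case: iP iQ => ? _ [].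
have [sR sS] : (1 < size R)%N /\ (1 < size S)%N by case: iR iS => ? _ [].
rewrite bu_sum_split // (bu_sum_split cardF sQ sb) addp1K // in E.
have [/and3P[PQ PR PS] /andP[QR QS] RS] :
    [/\ [&& P != P + 1, P != R & P != S], (P + 1 != R) && (P + 1 != S) & R != S].
  by move: uPQRS; rewrite /= !inE !negb_or => /and4P[-> -> -> _].
have [cSP cSQ] : coprimep S P /\ coprimep S (P + 1).
  by split; apply: irredp_coprime => //; rewrite eq_sym.
have [cRP cRQ] : coprimep R P /\ coprimep R (P + 1).
  by split; apply: irredp_coprime => //; rewrite eq_sym.
have SR_dvd : S ^+ d %| bu_sum R c.
  rewrite -(@Gauss_dvdpl _ _ ((P + 1) ^+ a * P ^+ b * bu_sum S d)).
    have -> : bu_sum R c * ((P + 1) ^+ a * P ^+ b * bu_sum S d) =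
      (P + 1) ^+ a * P ^+ b * bu_sum R c * bu_sum S d by ring.
    by rewrite E dvdp_mull.
  by rewrite coprimep_expl // !coprimepMr !coprimep_expr // coprime_bu_sum.
have RS_dvd : R ^+ c %| bu_sum S d.
  rewrite -(@Gauss_dvdpl _ _ ((P + 1) ^+ a * P ^+ b * bu_sum R c)).
    by rewrite mulrC E mulrAC dvdp_mull.
  by rewrite coprimep_expl // !coprimepMr !coprimep_expr // coprime_bu_sum.
have mRc : bu_sum R c \is monic by rewrite bu_sum_monic.
have mSd : bu_sum S d \is monic by rewrite bu_sum_monic.
have leE : ((size S).-1 * d <= (size R).-1 * c)%N.
  rewrite -size_exp -(size_bu_sum char2 sR) -!subn1 leq_sub2r //.
  by rewrite dvdp_leq // monic_neq0.
have geE : ((size R).-1 * c <= (size S).-1 * d)%N.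
  rewrite -size_exp -(size_bu_sum char2 sS) -!subn1 leq_sub2r //.
  by rewrite dvdp_leq // monic_neq0.
have degE : ((size R).-1 * c = (size S).-1 * d)%N by apply/eqP; rewrite eqn_leq leE geE.
have leq_pred A B : B != 0 -> ((size A).-1 <= (size B).-1)%N -> (size A <= size B)%N.
  by rewrite -size_poly_gt0; case: (size A) (size B) => [|m] [|n].
have RcE : bu_sum R c = S ^+ d.
  apply/esym/monic_dvdp_eq; rewrite ?monic_exp // leq_pred ?expf_neq0 ?monic_neq0 //.
  by rewrite size_exp size_bu_sum.
have SdE : bu_sum S d = R ^+ c.
  apply/esym/monic_dvdp_eq; rewrite ?monic_exp // leq_pred ?expf_neq0 ?monic_neq0 //.
  by rewrite size_exp size_bu_sum.
have ab : a = b.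
  have [] := @irred4_inj _ P (P + 1) R S b a c d a b c d mPQRS iPQRS uPQRS => //.
  by rewrite -E RcE SdE; ring.
split=> //; have [c0|c0] := posnP c.
  left; split=> //; move: degE; rewrite c0 muln0 => /esym/eqP.
  by rewrite muln_eq0 => /orP[] /eqP //; case: (size S) sS => [|[]].
have d0 : (0 < d)%N.
  rewrite lt0n; apply: contraTneq c0 => d0; move: degE; rewrite d0 muln0 => /eqP.
  by rewrite muln_eq0 => /orP[] /eqP; [case: (size R) sR => [|[]] | move->].
right.
have [e [f [RE SE]]] : exists e f, R + 1 = S ^+ e /\ S + 1 = R ^+ f.
  have := addp1_dvd_bu_sum char2 sR c0; have := addp1_dvd_bu_sum char2 sS d0.
  rewrite RcE SdE -[R ^+ c]mulr1 -[S ^+ d]mulr1.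
  case/(dvdp_irredXM mR iR) => [|f [U [_ mU ->]]]; first by rewrite monic_addp1.
  rewrite dvdp1 => /eqP/(monic_size1 mU)->.
  case/(dvdp_irredXM mS iS) => [|e [V [_ mV ->]]]; first by rewrite monic_addp1.
  rewrite dvdp1 => /eqP/(monic_size1 mV)->.
  by exists e, f; rewrite !mulr1.
have SR1 : S = R + 1.
  have := congr1 (fun A : {poly F} => (size A).-1) RE.
  have := congr1 (fun A : {poly F} => (size A).-1) SE.
  rewrite !size_exp !size_addp1 // => sSE sRE.
  suff e1 : e = 1%N by rewrite RE e1.
  have /eqP : ((size R).-1 * (f * e) = (size R).-1 * 1)%N by rewrite mulnA -sSE -sRE muln1.
  rewrite eqn_pmul2l; last by case: (size R) sR => [|[]].
  by rewrite muln_eq1 => /andP[_ /eqP].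
split=> //.
  move: degE; rewrite SR1 size_addp1 // => /eqP.
  by rewrite eqn_pmul2l; [move/eqP | case: (size R) sR => [|[]]].
have [//|[u [ou u1]]] := bu_sum_geom cardF sR c0.
rewrite RcE SR1 => gR; have : coprimep (geom R u) (geom R u).
  apply: coprimep_dvdl gR _; apply: coprimep_expr.
  by rewrite coprimep_sym coprime_addp1_geom.
rewrite coprimepp => /eqP g1; have := size_geom char2 sR u.-1.
rewrite prednK ?(ltnW u1) // g1 /= => /esym/eqP; rewrite muln_eq0.
by case: (size R) sR => [|[]] //; case: (u) u1 => [|[]].
Qed.

(** R + 1 divides [bu_sum R c] and is coprime to R. *)
Lemma addp1_factor P Q R S a b c d :
    [/\ P \is monic, Q \is monic, R \is monic & S \is monic] ->
    [/\ irreducible_poly P, irreducible_poly Q, irreducible_poly R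
      & irreducible_poly S] -> (0 < c)%N ->
    bu_sum R c %| P ^+ a * Q ^+ b * R ^+ c * S ^+ d ->
  exists i j l, R + 1 = P ^+ i * Q ^+ j * S ^+ l.
Proof.
move=> mPQRS iPQRS c0 RA; have [_ _ mR _] := mPQRS; have [_ _ iR _] := iPQRS.
have sR : (1 < size R)%N by case: iR.
have mR1 : R + 1 \is monic by rewrite monic_addp1.
have R1A := dvdp_trans (addp1_dvd_bu_sum char2 sR c0) RA.
have [i [j [k [l [_ _ _ _ RE]]]]] := dvdp_irred4 mPQRS iPQRS mR1 R1A.
exists i, j, l; have : coprimep R (R + 1).
  by have := coprimep_1addM R 1; rewrite mulr1 addrC.
rewrite RE; case: k RE => [|k] RE; first by rewrite mulr1.
by rewrite !coprimepMr [coprimep R (R ^+ _)]coprimep_pexpr // coprimepp gtn_eqF // andbF.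
Qed.

Lemma geom_perfect P R S a b c d u :
    [/\ P \is monic, P + 1 \is monic, R \is monic & S \is monic] ->
    [/\ irreducible_poly P, irreducible_poly (P + 1), irreducible_poly R
      & irreducible_poly S] ->
    uniq [:: P; P + 1; R; S] -> ~ [/\ size P = 2%N, size R = 2%N & size S = 2%N] ->
    (0 < a)%N -> (0 < b)%N ->
    ((0 < c)%N -> (size P <= size R)%N) -> ((0 < d)%N -> (size P <= size S)%N) ->
    bu_sum P a * bu_sum (P + 1) b * bu_sum R c * bu_sum S d =
      P ^+ a * (P + 1) ^+ b * R ^+ c * S ^+ d ->
    odd u -> (1 < u)%N -> geom P u %| bu_sum P a ->
  [/\ R \in [:: P ^+ 3 + P + 1; P ^+ 3 + P ^+ 2 + 1],
      S \in [:: P ^+ 3 + P + 1; P ^+ 3 + P ^+ 2 + 1]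
    & (a, b, c, d) \in [:: (7, 13, 2, 2); (13, 7, 2, 2); (14, 14, 2, 2)]%N].
Proof.
move=> mPQRS iPQRS uPQRS nl a0 b0 cPR dPS E ou u1 gP.
have [mP mQ mR mS] := mPQRS; have [iP iQ iR iS] := iPQRS.
have [|gRS c0 d0] := @geom_dvd4 _ cardF P R S u mP mR mS iP iQ iR iS ou u1 a b c d cPR dPS.
  by rewrite -E -!mulrA dvdp_mulr.
have [i' [j' [l RE]]] : exists i j l, R + 1 = P ^+ i * (P + 1) ^+ j * S ^+ l.
  by apply: (@addp1_factor P _ R S a b c d) => //; rewrite -E dvdp_mulr // dvdp_mull.
have [i [j [k SE]]] : exists i j l, S + 1 = P ^+ i * (P + 1) ^+ j * R ^+ l.
  by apply: (@addp1_factor P _ S R a b d c) => //; rewrite mulrAC -E dvdp_mull.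
have [_ RS] := geom_factors cardF (And3 mP mR mS) iPQRS uPQRS nl ou u1 gRS SE RE.
case: RS => -[R_eq S_eq].
  have [-> abc] := cubic_perfect cardF R_eq S_eq mPQRS iPQRS uPQRS (And4 a0 b0 c0 d0) E.
  split; rewrite ?R_eq ?S_eq ?inE ?eqxx ?orbT //.
  by move: abc; rewrite !inE => /or3P[] /eqP[-> -> ->].
have uPQSR : uniq [:: P; P + 1; S; R].
  move: uPQRS; rewrite /= !inE !negb_or ![S == R]eq_sym.
  by move=> /and4P[/and3P[-> -> ->] /andP[-> ->] -> _].
have E' : bu_sum P a * bu_sum (P + 1) b * bu_sum S d * bu_sum R c =
    P ^+ a * (P + 1) ^+ b * S ^+ d * R ^+ c by rewrite mulrAC E mulrAC.
have [-> abc] := cubic_perfect cardF R_eq S_eq (And4 mP mQ mS mR) (And4 iP iQ iS iR)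
  uPQSR (And4 a0 b0 d0 c0) E'.
split; rewrite ?R_eq ?S_eq ?inE ?eqxx ?orbT //.
by move: abc; rewrite !inE => /or3P[] /eqP[-> -> ->].
Qed.

Lemma bu_perfect_exponents P R S a b c d :
    [/\ P \is monic, P + 1 \is monic, R \is monic & S \is monic] ->
    [/\ irreducible_poly P, irreducible_poly (P + 1), irreducible_poly R
      & irreducible_poly S] ->
    uniq [:: P; P + 1; R; S] -> ~ [/\ size P = 2%N, size R = 2%N & size S = 2%N] ->
    (0 < a)%N -> (0 < b)%N ->
    ((0 < c)%N -> (size P <= size R)%N) -> ((0 < d)%N -> (size P <= size S)%N) ->
    bu_sum P a * bu_sum (P + 1) b * bu_sum R c * bu_sum S d =
      P ^+ a * (P + 1) ^+ b * R ^+ c * S ^+ d ->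
  [\/ [/\ a = b, split_exponent a, c = 0%N & d = 0%N],
      [/\ a = b, split_exponent a, c = d, split_exponent c & S = R + 1]
    | [/\ R \in [:: P ^+ 3 + P + 1; P ^+ 3 + P ^+ 2 + 1],
          S \in [:: P ^+ 3 + P + 1; P ^+ 3 + P ^+ 2 + 1]
        & (a, b, c, d) \in [:: (7, 13, 2, 2); (13, 7, 2, 2); (14, 14, 2, 2)]%N]].
Proof.
move=> mPQRS iPQRS uPQRS nl a0 b0 cPR dPS E.
have [mP mQ mR mS] := mPQRS; have [iP iQ iR iS] := iPQRS.
have [sP sQ] : (1 < size P)%N /\ (1 < size (P + 1)%R)%N by case: iP iQ => ? _ [].
have [sa|[u [ou u1 gu]]] := bu_sum_geom cardF sP a0; last first.
  by apply: Or33; apply: geom_perfect nl a0 b0 cPR dPS E ou u1 gu.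
have [sb|[u [ou u1 gu]]] := bu_sum_geom cardF sQ b0; last first.
  apply: Or33.
  (* P and P + 1 change roles; the two cubics are exchanged, and the list of exponents is symmetric
     in a and b. *)
  have mQPRS := And4 mQ mP mR mS; have iQPRS := And4 iQ iP iR iS.
  have PK := addp1K cardF P; have sPQ := size_addp1 sP.
  have uQPRS : uniq [:: P + 1; P + 1 + 1; R; S].
    rewrite PK; move: uPQRS; rewrite /= !inE !negb_or [P + 1 == P]eq_sym.
    by move=> /and4P[/and3P[-> -> ->] /andP[-> ->] -> _].
  have E' : bu_sum (P + 1) b * bu_sum (P + 1 + 1) a * bu_sum R c * bu_sum S d =
      (P + 1) ^+ b * (P + 1 + 1) ^+ a * R ^+ c * S ^+ d.
    by rewrite PK [bu_sum _ b * _]mulrC [(P + 1) ^+ b * _]mulrC.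
  have := geom_perfect (a := b) (b := a) _ _ uQPRS _ b0 a0 _ _ E' ou u1 gu.
  rewrite sPQ PK => /(_ mQPRS iQPRS nl cPR dPS).
  case.
  rewrite (cubic_addp1 cardF) (cubic_addp1' cardF) !inE => RE SE abcd.
  split; [by rewrite orbC | by rewrite orbC |].
  by move: abcd => /or3P[] /eqP[-> -> -> ->].
have [ab [[c0 d0]|[cd sc SR]]] := split_perfect mPQRS iPQRS uPQRS sa sb E.
  by apply: Or31.
by apply: Or32.
Qed.

End ExponentClassification.

(** * Prime factorization by multiplicities *)

Section Factorization.

Variable F : finFieldType.
Implicit Types P Q R S T U V D E A B : {poly F}.

(** A nonconstant monic divisor of least degree is irreducible. *)
Lemma exists_irred_factor A : A \is monic -> (1 < size A)%N ->
  exists P, [/\ P \is monic, irreducible_poly P & P %| A].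
Proof.
move=> mA sA; have A0 := monic_neq0 mA.
pose has_divisor n := has (fun D => (1 < size D)%N && (size D == n)) (monic_divisors A).
have exD : exists n, has_divisor n.
  by exists (size A); apply/hasP; exists A; rewrite ?mem_monic_divisors ?mA ?dvdpp ?sA /=.
case: (ex_minnP exD) => n /hasP[D]; rewrite mem_monic_divisors // => /andP[mD DA].
move=> /andP[sD /eqP sDn] minD; exists D; split=> //; split=> // q sq1 qD.
have q0 : q != 0 by apply: contraTneq qD => ->; rewrite dvd0p monic_neq0.
have lq : lead_coef q != 0 by rewrite lead_coef_eq0.
have sq : (1 < size q)%N by rewrite ltn_neqAle eq_sym sq1 size_poly_gt0.
rewrite -dvdp_size_eqp // eqn_leq dvdp_leq ?monic_neq0 // sDn.
apply: minD; apply/hasP; exists ((lead_coef q)^-1 *: q); last first.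
  by rewrite size_scale ?invr_eq0 // sq eqxx.
rewrite mem_monic_divisors // monicE lead_coefZ mulVf // eqxx /=.
by rewrite dvdpZl ?invr_eq0 //; apply: dvdp_trans DA.
Qed.

Lemma multiplicity_dvdp A P : P ^+ multiplicity P A %| A.
Proof.
apply: (big_ind (fun k => P ^+ k %| A)) => [|i j iA jA|//]; first exact: dvd1p.
by rewrite /maxn; case: ifP.
Qed.

Lemma leq_multiplicity A P k : A != 0 -> (1 < size P)%N -> P ^+ k %| A ->
  (k <= multiplicity P A)%N.
Proof.
move=> A0 sP PkA; have kA : (k < size A)%N.
  apply: leq_trans (dvdp_leq A0 PkA); have := size_exp P k.
  have : P ^+ k != 0 by rewrite expf_neq0 // -size_poly_gt0 ltnW.
  rewrite -size_poly_gt0; case: (size (P ^+ k)) => //= s _ ->.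
  by rewrite ltnS leq_pmull //; case: (size P) sP => [|[]].
exact: (@leq_bigmax_cond _ (fun k : 'I_(size A) => P ^+ k %| A)
  (fun k => k : nat) (Ordinal kA)).
Qed.

(** The prime powers are pairwise coprime, so their product divides A; a prime factor of the
    cofactor would exceed its multiplicity. *)
Lemma factorization A : A \is monic ->
  A = \prod_(P <- irr_factors A) P ^+ multiplicity P A.
Proof.
move=> mA; have A0 := monic_neq0 mA.
have irrA P : P \in irr_factors A -> [/\ P \is monic, irreducible_poly P & P %| A].
  by move/(mem_irr_factors _ A0).
have mB s : {subset s <= irr_factors A} -> \prod_(P <- s) P ^+ multiplicity P A \is monic.
  move=> sA; rewrite big_seq; apply: monic_prod => P /sA/irrA[mP _ _]; exact: monic_exp.
have BA : \prod_(P <- irr_factors A) P ^+ multiplicity P A %| A.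
  have : uniq (irr_factors A) by rewrite filter_uniq // monic_divisors_uniq.
  have : {subset irr_factors A <= irr_factors A} by [].
  elim: {1 3 4}(irr_factors A) => [|P s IHs] sA /=; first by rewrite big_nil dvd1p.
  case/andP=> Ps us; rewrite big_cons Gauss_dvdp.
    rewrite multiplicity_dvdp // IHs // => Q Qs; apply: sA.
    by rewrite inE Qs orbT.
  apply: coprimep_expl; rewrite big_seq.
  apply: (big_ind (coprimep P)) => [|B C cB cC|Q Qs]; first exact: coprimep1.
    by rewrite coprimepMr cB.
  apply: coprimep_expr.
  have [mP iP _] := irrA P (sA P (mem_head _ _)).
  have [mQ iQ _] := irrA Q (sA Q (mem_behead (s := P :: s) Qs)).
  by apply: irredp_coprime => //; apply: contraNneq Ps => ->.
have [C mC AE] := monic_dvdpP mA (mB _ (fun P => id)) BA.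
have [sC|sC] := leqP (size C) 1; last first.
  have [P [mP iP PC]] := exists_irred_factor mC sC.
  have PA : P %| A by rewrite AE dvdp_mull.
  have Ps : P \in irr_factors A by apply/(mem_irr_factors _ A0).
  have sP : (1 < size P)%N by case: iP.
  suff /(leq_multiplicity A0 sP) : P ^+ (multiplicity P A).+1 %| A by rewrite ltnn.
  rewrite [X in _ %| X]AE (big_rem P) //= exprSr -mulrA.
  by rewrite dvdp_mul // dvdp_mull.
rewrite {1}AE (_ : C = 1) ?mulr1 //; apply: monic_size1 => //.
by apply/eqP; rewrite eqn_leq sC size_poly_gt0 monic_neq0.
Qed.

(** Supplies the linear placeholders that carry exponent 0. *)
Lemma exists_linear_notin (s : seq {poly F}) : (size s < #|F|)%N ->
  exists x : F, 'X - x%:P \notin s.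
Proof.
move=> sF; apply/existsP; apply: contraTT sF; rewrite negb_exists -leqNgt => /forallP all_in.
rewrite cardE -(size_map (fun x : F => 'X - x%:P)); apply: uniq_leq_size.
  by rewrite map_inj_uniq ?enum_uniq // => x y /addrI/oppr_inj/polyC_inj.
by move=> _ /mapP[x _ ->]; have := all_in x; rewrite negbK.
Qed.

End Factorization.

(** * Normal form of a bi-unitary perfect polynomial *)

Section Perfect.

Variable F : finFieldType.
Hypothesis cardF : #|F| = 4%N.
Implicit Types P Q R S T U V D E A B : {poly F}.

Let char2 := F4_pchar2 cardF.

Lemma sigma_bu_irred4 P Q R S a b c d :
    [/\ P \is monic, Q \is monic, R \is monic & S \is monic] ->
    [/\ irreducible_poly P, irreducible_poly Q, irreducible_poly R
      & irreducible_poly S] -> uniq [:: P; Q; R; S] ->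
  sigma_bu (P ^+ a * Q ^+ b * R ^+ c * S ^+ d) =
    bu_sum P a * bu_sum Q b * bu_sum R c * bu_sum S d.
Proof.
move=> [mP mQ mR mS] [iP iQ iR iS].
rewrite /= !inE !negb_or => /and4P[/and3P[PQ PR PS] /andP[QR QS] RS _].
have cX T U n m : T \is monic -> U \is monic -> irreducible_poly T ->
    irreducible_poly U -> T != U -> coprimep (T ^+ n) (U ^+ m).
  by move=> *; apply/coprimep_expl/coprimep_expr/irredp_coprime.
by rewrite !sigma_buM ?sigma_buX ?coprimepMl ?cX ?monicMl ?monic_exp.
Qed.

Lemma splits_irred4 P Q R S a b c d :
    [/\ P \is monic, Q \is monic, R \is monic & S \is monic] ->
    [/\ size P = 2, size Q = 2, size R = 2 & size S = 2]%N ->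
  splits (P ^+ a * Q ^+ b * R ^+ c * S ^+ d).
Proof.
move=> [mP mQ mR mS] [sP sQ sR sS].
exists (nseq a P ++ nseq b Q ++ nseq c R ++ nseq d S).
  by rewrite !all_cat !all_nseq mP mQ mR mS sP sQ sR sS !orbT.
by rewrite !big_cat !big_nseq -!Monoid.iteropE /= !mulrA.
Qed.

(** An irreducible factor of P + 1 divides [sigma_bu A] = A. By minimality its degree is at least
    deg P, so it is P + 1. *)
Lemma bu_perfect_addp1 A P : A \is monic -> biunitary_perfect A ->
    P \in irr_factors A -> (forall Q, Q \in irr_factors A -> (size P <= size Q)%N) ->
  P + 1 \in irr_factors A.
Proof.
move=> mA pA PA minP; have A0 := monic_neq0 mA.
have /(mem_irr_factors _ A0)[mP iP dPA] := PA; have sP : (1 < size P)%N by case: iP.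
have mQ : P + 1 \is monic by rewrite monic_addp1.
pose e := multiplicity P A.
have e0 : (0 < e)%N by apply: (@leq_multiplicity _ A P 1).
have [B mB AE] := monic_dvdpP mA (monic_exp e mP) (multiplicity_dvdp A P).
have cPB : coprimep (P ^+ e) B.
  rewrite coprimep_pexpl // irreducible_poly_coprime //; apply/negP => PB.
  suff /(leq_multiplicity A0 sP) : P ^+ e.+1 %| A by rewrite ltnn.
  by rewrite AE exprSr dvdp_mul.
have QA : P + 1 %| A.
  rewrite -[A in _ %| A]pA AE sigma_buM ?monic_exp // sigma_buX // dvdp_mulr //.
  exact: addp1_dvd_bu_sum.
have [|T [mT iT TQ]] := exists_irred_factor mQ; first by rewrite size_addp1.
have TA : T \in irr_factors A by apply/(mem_irr_factors _ A0); split=> //; apply: dvdp_trans QA.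
by rewrite -(monic_dvdp_eq mT mQ TQ) // size_addp1 // minP.
Qed.

Lemma bu_perfect_irred4 A : A \is monic -> ~ splits A ->
    (size (irr_factors A) <= 4)%N ->
    ~~ all (fun P => odd (multiplicity P A)) (irr_factors A) ->
    biunitary_perfect A ->
  exists P R S a b c d,
   [/\ [/\ P \is monic, P + 1 \is monic, R \is monic & S \is monic],
       [/\ irreducible_poly P, irreducible_poly (P + 1), irreducible_poly R
         & irreducible_poly S],
       uniq [:: P; P + 1; R; S],
       A = P ^+ a * (P + 1) ^+ b * R ^+ c * S ^+ d
     & [/\ (0 < a)%N, (0 < b)%N,
           (0 < c)%N -> (size P <= size R)%N, (0 < d)%N -> (size P <= size S)%N
         & ~ [/\ odd a, odd b, (0 < c)%N -> odd c & (0 < d)%N -> odd d]]].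
Proof.
move=> mA nsA omA expA pA; have A0 := monic_neq0 mA.
have uA : uniq (irr_factors A) by rewrite filter_uniq // monic_divisors_uniq.
have irrA P : P \in irr_factors A -> [/\ P \is monic, irreducible_poly P & P %| A].
  by move/(mem_irr_factors _ A0).
have multA P : P \in irr_factors A -> (0 < multiplicity P A)%N.
  by case/irrA => mP [sP _] PA; apply: (@leq_multiplicity _ A P 1).
have AE := factorization mA.
have [P PA minP] : exists2 P, P \in irr_factors A &
    forall Q, Q \in irr_factors A -> (size P <= size Q)%N.
  have exn : exists n, has (fun P => size P == n) (irr_factors A).
    (* Without prime factors A would be 1, which splits. *)
    case E : (irr_factors A) => [|P s]; last first.
      by exists (size P); rewrite /= eqxx.
    by case: nsA; exists [::]; rewrite // AE E !big_nil.
  case: (ex_minnP exn) => n /hasP[P PA /eqP sP] minn; exists P => // Q QA.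
  by rewrite sP minn //; apply/hasP; exists Q.
have QA := bu_perfect_addp1 mA pA PA minP.
have PQ : P + 1 != P by rewrite -subr_eq0 addrAC subrr add0r oner_neq0.
have [mP iP _] := irrA P PA; have [mQ iQ _] := irrA _ QA.
pose rest := rem (P + 1) (rem P (irr_factors A)).
have perm_s : perm_eq (irr_factors A) [:: P, P + 1 & rest].
  rewrite (permPl (perm_to_rem PA)) perm_cons perm_to_rem //.
  by rewrite mem_rem_uniq // inE PQ.
have us : uniq [:: P, P + 1 & rest] by rewrite -(perm_uniq perm_s).
have ss : (size rest <= 2)%N by move: omA; rewrite (perm_size perm_s).
have mem_s T : T \in rest -> T \in irr_factors A.
  by move=> Tr; rewrite (perm_mem perm_s) !inE Tr !orbT.
move: AE; rewrite (perm_big _ perm_s) /= !big_cons mulrA.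
move: expA; rewrite (perm_all _ perm_s) /=.
have lin (s : seq {poly F}) : (size s < 4)%N ->
    exists T, [/\ T \is monic, irreducible_poly T & T \notin s].
  rewrite -cardF => /exists_linear_notin[x xs]; exists ('X - x%:P).
  by rewrite monicXsubC; split=> //; apply: irredp_XsubC.
have uniq4 R S : R \notin [:: P; P + 1] -> S \notin [:: P; P + 1; R] ->
    uniq [:: P; P + 1; R; S].
  rewrite !inE !negb_or => /andP[RP RQ] /and3P[SP SQ SR].
  by rewrite /= !inE !negb_or ![_ == R]eq_sym ![_ == S]eq_sym RP RQ SP SQ SR eq_sym PQ.
case: rest {perm_s} us ss mem_s => [|R [|S [|//]]] us _ mem_s.
- have [R [mR iR Rs]] := lin [:: P; P + 1] isT.
  have [S [mS iS Ss]] := lin [:: P; P + 1; R] isT.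
  rewrite big_nil mulr1 andbT => nodd AE.
  exists P, R, S, (multiplicity P A), (multiplicity (P + 1) A), 0%N, 0%N.
  split=> //.
  + exact: uniq4 Rs Ss.
  + by rewrite !expr0 !mulr1.
  by split; rewrite ?multA // => -[oa ob _ _]; rewrite oa ob in nodd.
- have RA := mem_s R (mem_head _ _); have [mR iR _] := irrA R RA.
  have [S [mS iS Ss]] := lin [:: P; P + 1; R] isT.
  rewrite big_seq1 /= => nodd AE.
  exists P, R, S, (multiplicity P A), (multiplicity (P + 1) A), (multiplicity R A), 0%N.
  split=> //.
  + apply: uniq4 Ss; move: us; rewrite /= !inE !negb_or => /and3P[/andP[_ +] + _].
    by rewrite ![_ == R]eq_sym => -> ->.
  + by rewrite expr0 mulr1.
  split; rewrite ?multA // ?minP // => -[oa ob oc _].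
  by rewrite oa ob oc ?multA in nodd.
have RA := mem_s R (mem_head _ _); have [mR iR _] := irrA R RA.
have SA : S \in irr_factors A by apply: mem_s; rewrite !inE eqxx orbT.
have [mS iS _] := irrA S SA.
rewrite big_cons big_seq1 mulrA /= => nodd AE.
exists P, R, S, (multiplicity P A), (multiplicity (P + 1) A), (multiplicity R A),
  (multiplicity S A).
split=> //.
split; rewrite ?multA // ?minP // => -[oa ob oc od].
by rewrite oa ob oc ?od ?multA in nodd.
Qed.

End Perfect.

(** * The listed polynomials are bi-unitary perfect *)

Section Converse.

Variable F : finFieldType.
Hypothesis cardF : #|F| = 4%N.
Implicit Types P Q R S T U V D E A B : {poly F}.

Let char2 := F4_pchar2 cardF.

Lemma bu_perfect_split P R a b c d (Q := P + 1) (S := R + 1) :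
    [/\ P \is monic, Q \is monic, R \is monic & S \is monic] ->
    [/\ irreducible_poly P, irreducible_poly Q, irreducible_poly R
      & irreducible_poly S] -> uniq [:: P; Q; R; S] ->
    split_exponent a -> split_exponent c -> b = a -> d = c ->
  biunitary_perfect (P ^+ a * Q ^+ b * R ^+ c * S ^+ d).
Proof.
move=> mPQRS iPQRS uPQRS sa sc -> ->; have [[sP _] [sQ _] [sR _] [sS _]] := iPQRS.
rewrite /biunitary_perfect sigma_bu_irred4 // !bu_sum_split // !addp1K //.
by rewrite -/Q -/S; ring.
Qed.

Lemma bu_sum7 P : (1 < size P)%N -> bu_sum P 7 = (P + 1) ^+ 7.
Proof. by move=> sP; apply: bu_sum_split => //; right; exists 3. Qed.

Lemma bu_sum13 P : (1 < size P)%N -> bu_sum P 13 = (P + 1) * geom P 7 ^+ 2.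
Proof. by move=> sP; rewrite bu_sum_odd // (geom_pow2 char2 sP 1 7). Qed.

Lemma bu_sum14 P : (1 < size P)%N -> bu_sum P 14 = (P + 1) ^+ 8 * geom P 7.
Proof.
move=> sP; rewrite (bu_sum_even char2 sP (m := 7)) // (geom_pow2 char2 sP 3 1) geom1.
by rewrite expr1n mulr1 -exprS.
Qed.

(** Here (R + 1) (S + 1) = P^3 (P + 1)^3, so R^2 and S^2 contribute P^6 (P + 1)^6. The sums for P
    and P + 1 provide (R S)^2 and the missing powers of P and P + 1. *)
Lemma bu_perfect_seven P R S a b c d :
    [/\ P \is monic, P + 1 \is monic, R \is monic & S \is monic] ->
    [/\ irreducible_poly P, irreducible_poly (P + 1), irreducible_poly R
      & irreducible_poly S] -> uniq [:: P; P + 1; R; S] ->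
    R \in [:: P ^+ 3 + P + 1; P ^+ 3 + P ^+ 2 + 1] ->
    S \in [:: P ^+ 3 + P + 1; P ^+ 3 + P ^+ 2 + 1] ->
    (a, b, c, d) \in [:: (7, 13, 2, 2); (13, 7, 2, 2); (14, 14, 2, 2)]%N ->
  biunitary_perfect (P ^+ a * (P + 1) ^+ b * R ^+ c * S ^+ d).
Proof.
move=> mPQRS iPQRS uPQRS RP SP abcd; have [[sP _] [sQ _] [sR _] [sS _]] := iPQRS.
have RS : R != S by move: uPQRS; rewrite /= !inE => /and4P[].
pose A3 := P ^+ 3 + P + 1; pose B3 := P ^+ 3 + P ^+ 2 + 1.
have AB : (R + 1) * (S + 1) = P ^+ 3 * (P + 1) ^+ 3 /\ R * S = A3 * B3.
  have E : (A3 + 1) * (B3 + 1) = P ^+ 3 * (P + 1) ^+ 3.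
    by rewrite addp1K // /A3 addp1K //; apply: (eq_pchar2 cardF (T := - (P ^+ 5 + P ^+ 4))); ring.
  move: RP SP RS; rewrite !inE => /orP[] /eqP -> /orP[] /eqP ->; rewrite ?eqxx // => _.
  by split; [rewrite mulrC; exact: E | rewrite mulrC].
have [E RSE] := AB.
have gP : geom P 7 = R * S by rewrite geom7E.
have gQ : geom (P + 1) 7 = R * S by rewrite geom7E // cubic_addp1 // cubic_addp1' // mulrC.
have E2 : bu_sum R 2 * bu_sum S 2 = P ^+ 6 * (P + 1) ^+ 6.
  rewrite !bu_sum_split //; try by left.
  by rewrite -exprMn E exprMn -!exprM.
have PK := addp1K cardF P.
move: abcd; rewrite !inE => /or3P[] /eqP[-> -> -> ->];
  rewrite /biunitary_perfect sigma_bu_irred4 // -mulrA E2.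
- by rewrite bu_sum7 // bu_sum13 // gQ PK; ring.
- by rewrite bu_sum7 // bu_sum13 // gP PK; ring.
- by rewrite !bu_sum14 // gP gQ PK; ring.
Qed.

End Converse.

Theorem theorem1p2 (F : finFieldType) (cardF : #|F| = 4%N) (A : {poly F})
  (Amonic : A \is monic) (Ansplit : ~ splits A)
  (Aomega : (size (irr_factors A) <= 4)%N)
  (Aexp : ~~ all (fun P => odd (multiplicity P A)) (irr_factors A)) :
  biunitary_perfect A <->
  exists (P Q R S : {poly F}) (a b c d : nat),
    [/\ [/\ P \is monic, Q \is monic, R \is monic & S \is monic],
        [/\ irreducible_poly P, irreducible_poly Q,
            irreducible_poly R & irreducible_poly S],
        uniq [:: P; Q; R; S],
        A = P ^+ a * Q ^+ b * R ^+ c * S ^+ d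
      & [\/ [/\ [/\ a = 2%N, b = 2%N, c = 2%N & d = 2%N],
                Omega1 P, Omega1 R, Q = P + 1 & S = R + 1],
            [/\ a = 2%N /\ b = 2%N,
                exists n : nat, c = (2 ^ n - 1)%N /\ d = (2 ^ n - 1)%N,
                Omega1 P /\ Omega1 R, Q = P + 1 & S = R + 1],
            [/\ exists n : nat, a = (2 ^ n - 1)%N /\ b = (2 ^ n - 1)%N,
                c = 2%N /\ d = 2%N,
                Omega1 P /\ Omega1 R, Q = P + 1 & S = R + 1]
          | [/\ Omega2 P, Q = P + 1,
                R \in [:: P ^+ 3 + P + 1; P ^+ 3 + P ^+ 2 + 1],
                S \in [:: P ^+ 3 + P + 1; P ^+ 3 + P ^+ 2 + 1]
              & (a, b, c, d) \in [:: (7, 13, 2, 2)%N; (13, 7, 2, 2)%N;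
                                     (14, 14, 2, 2)%N] ]]].
Proof.
have char2 := F4_pchar2 cardF.
split; last first.
  case=> P [Q [R [S [a [b [c [d [mPQRS iPQRS uPQRS ->]]]]]]]].
  have s2 : split_exponent 2 by left.
  have sn n : split_exponent (2 ^ n - 1) by right; exists n.
  case=> [[[-> -> -> ->] _ _ QE SE]|[[-> ->] [n [-> ->]] _ QE SE]|
          [[n [-> ->]] [-> ->] _ QE SE]|[_ QE RP SP abcd]]; subst.
  - exact: bu_perfect_split.
  - exact: bu_perfect_split.
  - exact: bu_perfect_split.
  - exact: bu_perfect_seven abcd.
move=> pA.
have [P [R [S [a [b [c [d [mPQRS iPQRS uPQRS AE [a0 b0 cPR dPS nodd]]]]]]]]] :=
  bu_perfect_irred4 cardF Amonic Ansplit Aomega Aexp pA.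
have [mP mQ mR mS] := mPQRS; have [iP iQ iR iS] := iPQRS.
have [sP _] := iP.
have E : bu_sum P a * bu_sum (P + 1) b * bu_sum R c * bu_sum S d =
    P ^+ a * (P + 1) ^+ b * R ^+ c * S ^+ d by rewrite -sigma_bu_irred4 // -AE.
have nl : ~ [/\ size P = 2%N, size R = 2%N & size S = 2%N].
  case=> sP2 sR2 sS2; apply: Ansplit; rewrite AE; apply: splits_irred4 => //.
  by split; rewrite ?size_addp1.
have odd_split n : odd (2 ^ n - 1) = (0 < n)%N.
  by case: n => // n; rewrite oddB ?expn_gt0 // expnS oddM.
have [[ab sa c0 d0]|[ab sa cd sc SE]|[RP SP abcd]] :=
  bu_perfect_exponents cardF mPQRS iPQRS uPQRS nl a0 b0 cPR dPS E.
- have a2 : a = 2%N.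
    case: sa => // -[n an]; case: nodd; rewrite -ab c0 d0 an odd_split.
    by split=> //; move: a0; rewrite an; case: (n).
  have sP2 : (2 < size P)%N.
    rewrite ltn_neqAle sP andbT; apply/eqP => sP2; apply: Ansplit.
    have -> : A = P ^+ a * (P + 1) ^+ b * P ^+ 0 * P ^+ 0 by rewrite AE c0 d0 !expr0.
    by apply: splits_irred4; split; rewrite ?size_addp1.
  have sX1 : size ('X + 1 : {poly F}) = 2%N by rewrite size_XaddC.
  (* With only two prime factors, c = d = 0 = 2^0 - 1 fits the second condition. It still asks for a
     pair R, R + 1 of primes; X and X + 1 will do, as P is not linear. *)
  exists P, (P + 1), 'X, ('X + 1), a, b, c, d.
  have mX1 : ('X + 1 : {poly F}) \is monic by rewrite monic_addp1 ?size_polyX // monicX.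
  have iX : irreducible_poly ('X : {poly F}).
    by have := irredp_XaddC (0 : F); rewrite addr0.
  have iX1 : irreducible_poly ('X + 1 : {poly F}) by apply: (irredp_XaddC (1 : F)).
  split=> //; first by rewrite monicX.
  + have nlin (T U : {poly F}) : (2 < size T)%N -> size U = 2%N -> T != U.
      by move=> sT sU; apply: contraTneq sT => ->; rewrite sU.
    have sQ2 : (2 < size (P + 1)%R)%N by rewrite size_addp1.
    have add1_neq T : T != T + 1 :> {poly F}.
      by rewrite eq_sym -subr_eq0 addrAC subrr add0r oner_neq0.
    by rewrite /= !inE !negb_or !add1_neq !(nlin P) ?(nlin (P + 1)) ?size_polyX.
  + by rewrite {1}AE c0 d0 !expr0.
  apply: Or42; split=> //; first by rewrite -ab a2.
  - by exists 0%N.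
  - by split; split; rewrite ?monicX.
- have omegaPR : Omega1 P /\ Omega1 R by split; split=> //; rewrite -SE.
  exists P, (P + 1), R, S, a, b, c, d; split=> //.
  case: sa sc ab cd => [->|[n an]] [->|[m cm]] ab cd.
  + by apply: Or41; rewrite -ab -cd; case: omegaPR.
  + by apply: Or42; rewrite -ab -cd cm; split=> //; exists m.
  + by apply: Or43; rewrite -ab -cd an; split=> //; exists n.
  (* Exponents 2^n - 1 on both pairs are odd whenever positive, which the hypothesis on the
     exponents forbids. *)
  case: nodd; rewrite -ab -cd an cm !odd_split.
  by split; [move: a0; rewrite an; case: (n) | move: a0; rewrite an; case: (n) |
    case: (m) | case: (m)].
exists P, (P + 1), R, S, a, b, c, d; split=> //; apply: Or44; split=> //.
have RS : R != S by move: uPQRS; rewrite /= !inE => /and4P[].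
split=> //; move: RP SP RS iR iS; rewrite !inE.
  by move=> /orP[] /eqP -> /orP[] /eqP ->; rewrite ?eqxx.
by move=> /orP[] /eqP -> /orP[] /eqP ->; rewrite ?eqxx.
Qed.
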